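(* Assume that one of the following two sets of conditions holds: (i) $A=A_{\alpha,\beta}=\alpha\mathbf 1_{s\times s}+(\beta-\alpha)I_s$ with $0<\alpha<\beta$, $\gamma_k=1/s$ for all $k$, and $\lVert\sqrt\Gamma\mathcal A\sqrt\Gamma\rVert_2<\zeta_q$; or (ii) $A$ is a symmetric positive definite $s\times s$ matrix with $A_{j,k}>0$ for all $j,k$, $\gamma_k>0$ for all $k=1,\dots,s$, and $\lVert\sqrt\Gamma\mathcal A\sqrt\Gamma\rVert_2<4\frac{q-1}{q}$. Then for any $0<\theta<1/2$ the distribution of $\mathcal R\,\mathcal S^{\theta}(m-\frac1q\mathbf 1_{sq})$ under the Gibbs measure $\mu_N$ satisfies a moderate deviation principle with speed $N^{1-2\theta}$ and good rate function $$\Lambda(t)=\frac12\,t^T\Big(\big(q\operatorname{diag}(\gamma)^{1-2\theta}-\operatorname{diag}(\gamma)^{1-\theta}A\operatorname{diag}(\gamma)^{1-\theta}\big)\otimes I_{q-1}\Big)t,\qquad t\in\mathbb R^{s(q-1)}.$$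
   Context: Block Potts model. Fix integers $s\ge1$ (number of blocks) and $q\ge2$ (number of colors). For each $N\in\mathbb N$ the set $\{1,\dots,N\}$ is partitioned into $s$ non-empty blocks $S_1,\dots,S_s$ (depending on $N$), and the limits $\gamma_k=\lim_{N\to\infty}|S_k|/N$ are assumed to exist. $\mathbf 1_{d\times e}$ is the $d\times e$ all-ones matrix, $\mathbf 1_d=\mathbf 1_{d\times1}$, $I_d$ is the identity matrix, $\otimes$ is the Kronecker product, $e_k\in\mathbb R^s$, $e_c\in\mathbb R^q$ are standard unit vectors, $\lVert\cdot\rVert_2$ is the spectral norm. Let $A$ be the $s\times s$ interaction matrix, $S=\operatorname{diag}(|S_1|,\dots,|S_s|)$, $\mathcal S=S\otimes I_q$, $\mathcal A=A\otimes I_q$, $\Gamma=\lim_{N\to\infty}\mathcal S/N=\operatorname{diag}(\gamma)\otimes I_q$. For $\omega\in\{1,\dots,q\}^N$ the magnetization is the vector $m=m(\omega)\in\mathbb R^{sq}$ with components $m_{k,c}=(e_k\otimes e_c)^Tm=\frac1{|S_k|}\sum_{i\in S_k}\mathbf 1_{\{\omega_i=c\}}$. The Hamiltonian is $H_N(\omega)=-\frac1{2N}m^T\mathcal S\mathcal A\mathcal S m$ and the Gibbs measure on $\{1,\dots,q\}^N$ is $\mu_N(\omega)=\exp(-H_N(\omega))/\sum_{\omega'}\exp(-H_N(\omega'))$. Critical value: $\zeta_q=2\,\frac{q-1}{q-2}\log(q-1)$ for $q\ge3$, and $\zeta_2=2$. Rotation: let $\tilde R\in SO(q)$ be a rotation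 with $\tilde R\,\frac1{\sqrt q}\mathbf 1_q=e_q$, let $\tilde P$ be the $(q-1)\times q$ matrix projecting onto the first $q-1$ coordinates, and put $\mathcal R=I_s\otimes\tilde P\tilde R$. A moderate deviation principle with speed $a_N$ and good rate function $\Lambda$ for probability measures $P_N$ on $\mathbb R^d$ means here a large deviation principle at that speed: $\Lambda:\mathbb R^d\to[0,\infty]$ has compact sublevel sets, $\limsup_N \frac1{a_N}\log P_N(F)\le-\inf_F\Lambda$ for all closed $F$, and $\liminf_N\frac1{a_N}\log P_N(G)\ge-\inf_G\Lambda$ for all open $G$. *)

(* Defs.v *)
From HB Require Import structures.
From mathcomp Require Import all_boot all_order all_algebra.
From mathcomp Require Import all_classical all_reals all_analysis.
From mathcomp Require Export mxtens.

Set Implicit Arguments.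
Unset Strict Implicit.
Unset Printing Implicit Defensive.

Import Order.TTheory GRing.Theory Num.Theory.
Import numFieldNormedType.Exports.

Local Open Scope classical_set_scope.
Local Open Scope ring_scope.

Record fdist (R : realType) (I : finType) := FDist {
  fd_fun :> I -> R;
  fd_ge0 : forall i, 0 <= fd_fun i;
  fd_sum1 : \sum_i fd_fun i = 1 }.

Section law.
Context (R : realType) (I : finType) (mu : fdist R I).
Context d (T : measurableType d) (X : I -> T).
Local Open Scope ereal_scope.

(* The image of mu under X. Every subset of the finite set I is an event, so
   every X : I -> T is a random variable. *)
Definition law_fun (B : set T) : \bar R := \sum_(i : I) (mu i)%:E * \d_(X i) B.

Let law0 : law_fun set0 = 0.
Proof. by rewrite /law_fun big1// => i _; rewrite measure0 mule0. Qed.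

Let law_ge0 B : 0 <= law_fun B.
Proof.
by apply: sume_ge0 => i _; rewrite mule_ge0// lee_fin; exact: fd_ge0.
Qed.

Let law_sigma_additive : semi_sigma_additive law_fun.
Proof.
move=> F mF tF mUF.
have -> : (fun n => \sum_(0 <= j < n) law_fun (F j)) =
    (fun n => \sum_(i : I) (mu i)%:E * \sum_(0 <= j < n) \d_(X i) (F j)).
  apply/funext => n; rewrite /law_fun exchange_big/=.
  by apply: eq_bigr => i _; rewrite ge0_sume_distrr// => j _; rewrite diracE.
apply: cvg_nnesum => [i _|i _]; last first.
  by apply: cvgeZl => //; exact: measure_semi_sigma_additive.
apply: nearW => n; apply: mule_ge0; first by rewrite lee_fin fd_ge0.
by apply: sume_ge0 => j _; rewrite diracE.
Qed.

HB.instance Definition _ :=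
  isMeasure.Build _ _ _ law_fun law0 law_ge0 law_sigma_additive.

Let law_setT : law_fun setT = 1.
Proof.
rewrite /law_fun (eq_bigr (fun i => (mu i)%:E)); last first.
  by move=> i _; rewrite diracT mule1.
by rewrite sumEFin fd_sum1.
Qed.

HB.instance Definition _ := Measure_isProbability.Build _ _ _ law_fun law_setT.

Definition law : probability T R := law_fun.

End law.

Definition borelType (T : ptopologicalType) := g_sigma_algebraType (@open T).

Section LDP.
Context (R : realType) (T : ptopologicalType).
Local Open Scope ereal_scope.

(* lne 0 = -oo and ereal_inf set0 = +oo, as in the usual conventions. *)
Record LDP (a : nat -> R) (P : nat -> probability (borelType T) R)
    (Lambda : T -> \bar R) : Prop := {
  LDP_ge0 : forall x, 0 <= Lambda x;
  LDP_compact : forall c : R, compact [set x | Lambda x <= c%:E];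
  LDP_upper : forall F : set T, closed F ->
    limn_esup (fun N => (a N)^-1%:E * lne (P N F)) <= - ereal_inf (Lambda @` F);
  LDP_lower : forall G : set T, open G ->
    - ereal_inf (Lambda @` G) <= limn_einf (fun N => (a N)^-1%:E * lne (P N G))
}.

End LDP.

Section matrices.
Context (R : realType).

Definition l2norm n (x : 'cV[R]_n) : R := Num.sqrt (\sum_i x i 0 ^+ 2).

Definition spectral_norm m n (M : 'M[R]_(m, n)) : R :=
  sup [set l2norm (M *m x) | x in [set x : 'cV[R]_n | l2norm x <= 1]].

Definition posdefmx n (M : 'M[R]_n) : Prop :=
  forall x : 'cV[R]_n, x != 0 -> 0 < (x^T *m M *m x) 0 0.

(* Real power of a diagonal matrix with nonnegative diagonal entries; the
   off-diagonal entries of M are ignored. For t = 2^-1 it is the square root. *)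
Definition diag_pow n (M : 'M[R]_n) (t : R) : 'M[R]_n :=
  diag_mx (\row_i (M i i `^ t)).

End matrices.

(* The colour set is 'I_q and the sites are 'I_N. A partition of the sites into
   s labelled blocks is encoded by its labelling bl : 'I_N -> 'I_s, with
   S_k = bl^-1(k). In R^(sq) = R^s (x) R^q, the coordinate (k, c) has index
   mxtens_index (k, c), the order used by the Kronecker product *t. *)
Section potts.
Context (R : realType) (s q N : nat) (bl : 'I_N -> 'I_s) (A : 'M[R]_s).

Definition block_card (k : 'I_s) : nat := #|[set i | bl i == k]|.

Definition blockmx : 'M[R]_s := diag_mx (\row_k (block_card k)%:R).

Definition blockmx_tens : 'M[R]_(s * q) := blockmx *t (1%:M : 'M[R]_q).

Definition magnetization (w : {ffun 'I_N -> 'I_q}) : 'cV[R]_(s * q) :=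
  \col_j let: (k, c) := mxtens_unindex j in
    (block_card k)%:R^-1 * \sum_(i | bl i == k) (w i == c)%:R.

Definition hamiltonian (w : {ffun 'I_N -> 'I_q}) : R :=
  let m := magnetization w in
  - (2 * N%:R)^-1 *
    (m^T *m blockmx_tens *m (A *t (1%:M : 'M[R]_q)) *m blockmx_tens *m m) 0 0.

Definition gibbs_weight (w : {ffun 'I_N -> 'I_q}) : R :=
  expR (- hamiltonian w) /
    \sum_(w' : {ffun 'I_N -> 'I_q}) expR (- hamiltonian w').

Lemma gibbs_weight_ge0 w : 0 <= gibbs_weight w.
Proof.
apply: divr_ge0; first exact: expR_ge0.
by apply: sumr_ge0 => w' _; exact: expR_ge0.
Qed.

Lemma gibbs_weight_sum1 : (1 < q)%N -> \sum_w gibbs_weight w = 1.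
Proof.
move=> q1; rewrite -mulr_suml divff// gt_eqF//.
pose w0 : {ffun 'I_N -> 'I_q} := [ffun=> Ordinal q1].
rewrite (bigD1 w0)//=; apply: ltr_pwDl; first exact: expR_gt0.
by apply: sumr_ge0 => w _; exact: expR_ge0.
Qed.

Definition gibbs (q1 : (1 < q)%N) : fdist R {ffun 'I_N -> 'I_q} :=
  FDist gibbs_weight_ge0 (gibbs_weight_sum1 q1).

End potts.

Arguments blockmx R {s N} bl.
Arguments blockmx_tens R {s} q {N} bl.
Arguments magnetization R {s q N} bl w.

Definition zeta (R : realType) (q : nat) : R :=
  if (q <= 2)%N then 2 else
    2 * ((q%:R - 1) / (q%:R - 2)) * ln (q%:R - 1).

Section rotation.
Context (R : realType) (q : nat).

Definition last_unit : 'cV[R]_q := \col_i (i.+1 == q)%:R.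

Definition proj_init : 'M[R]_(q.-1, q) := \matrix_(i, j) (i == j :> nat)%:R.

Definition ones_rotation (Rt : 'M[R]_q) : Prop :=
  [/\ Rt^T *m Rt = 1%:M, \det Rt = 1 &
      Rt *m ((Num.sqrt q%:R)^-1 *: const_mx 1) = last_unit].

Definition rotation_tens (s : nat) (Rt : 'M[R]_q) : 'M[R]_(s * q.-1, s * q) :=
  (1%:M : 'M[R]_s) *t (proj_init *m Rt).

End rotation.

Definition scaled_interaction (R : realType) (s q : nat) (gamma : 'rV[R]_s)
    (A : 'M[R]_s) : 'M[R]_(s * q) :=
  let sqrtGamma := diag_pow (diag_mx gamma *t (1%:M : 'M[R]_q)) 2^-1 in
  sqrtGamma *m (A *t (1%:M : 'M[R]_q)) *m sqrtGamma.

Definition rate_matrix (R : realType) (s : nat) (q : nat) (gamma : 'rV[R]_s)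
    (A : 'M[R]_s) (theta : R) : 'M[R]_s :=
  let G := diag_mx gamma in
  q%:R *: diag_pow G (1 - 2 * theta)
    - diag_pow G (1 - theta) *m A *m diag_pow G (1 - theta).

Definition rate (R : realType) (s q : nat) (gamma : 'rV[R]_s) (A : 'M[R]_s)
    (theta : R) (t : 'cV[R]_(s * q.-1)) : R :=
  2^-1 * (t^T *m (rate_matrix q gamma A theta *t (1%:M : 'M[R]_q.-1)) *m t) 0 0.

Definition rescaled_magnetization (R : realType) (s q N : nat)
    (bl : 'I_N -> 'I_s) (Rt : 'M[R]_q) (theta : R)
    (w : {ffun 'I_N -> 'I_q}) : 'cV[R]_(s * q.-1) :=
  rotation_tens s Rt *m diag_pow (blockmx_tens R q bl) theta
    *m (magnetization R bl w - q%:R^-1 *: const_mx 1).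

(* Main.v *)
(** Let D(x) = sum_c x_c ln (q x_c). Summing exp (sum_k |S_k| D(m_k)) over all
    configurations gives at most (N + 1)^(sq) q^N, since every configuration
    weighs at most 1 under the product law with its own colour frequencies and
    there are polynomially many frequency vectors. As the energy Q, a quadratic
    form in m - 1/q, is nonnegative, the Gibbs probability of an event is at most
    (N + 1)^(sq) exp (- min (sum_k |S_k| D(m_k) - Q)) over that event. The sharp
    inequality D(x) >= (zeta_q / 2) |x - 1/q|^2 makes the exponent coercive below
    the critical value, and near 1/q it is the quadratic rate function, because
    D(x) ~ (q / 2) |x - 1/q|^2. For the lower bound the configurations are tilted
    to the product law with colour frequencies 1/q + |S_k|^(-theta) x_k, under
    which the magnetization concentrates. *)

Require Import Defs.
From mathcomp Require Import all_boot all_order all_algebra.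
From mathcomp Require Import all_classical all_reals all_analysis.
From mathcomp Require Import ring lra.
Import Order.TTheory GRing.Theory Num.Theory.
Import numFieldNormedType.Exports.
Local Open Scope classical_set_scope.
Local Open Scope ring_scope.

Set Implicit Arguments.
Unset Strict Implicit.
Unset Printing Implicit Defensive.

(** * The entropy inequality *)

Section real_inequalities.
Context (R : realType).
Implicit Types (f df : R -> R) (a b u v x K : R).

(** Two entropy bounds are needed. The constant zeta_q / 2 is valid on the whole simplex, but for q
    >= 3 it falls short of the curvature q / 2 at the uniform vector, so it serves only to exclude
    large rescaled magnetizations. The constant q / 2 is valid only up to a relative error of order
    |m - 1/q|; a bounded rescaled magnetization makes this distance of order n^(-theta), with n the
    block size, and theta > 0 lets the error vanish. The condition theta < 1/2 makes N^(1 - 2 theta)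
    a positive power of N: it dominates the logarithm of the polynomial counting factor, and it is
    the order of the concentration exponent of the tilted law on a window of width n^(-theta).

    The value of zeta_q is dictated by coexistence: entropy and quadratic form touch not only at the
    uniform vector but also at the vectors that give mass (q - 1)/q to one colour and spread the
    rest evenly. For q = 2 these points merge, and a second-order condition takes over. *)

Lemma is_derive_MVT f df a b : a <= b ->
    (forall x, a <= x <= b -> is_derive x 1 f (df x)) ->
  exists2 c, a <= c <= b & f b - f a = df c * (b - a).
Proof.
move=> ab fdf.
have [x||c] := @MVT_segment R f df a b ab.
- by rewrite in_itv/= => /andP[ax xb]; apply: fdf; rewrite !ltW.
- apply: derivable_within_continuous => x; rewrite in_itv/= => xab.
  by have := fdf x xab; case.
by rewrite in_itv/=; exists c.
Qed.

Lemma is_derive_ge0_le f df a b : a <= b ->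
    (forall x, a <= x <= b -> is_derive x 1 f (df x)) ->
    (forall x, a <= x <= b -> 0 <= df x) -> f a <= f b.
Proof.
move=> ab /(is_derive_MVT ab)[c cab fba] df0.
by rewrite -subr_ge0 fba mulr_ge0 ?subr_ge0// df0.
Qed.

Lemma is_derive_le0_le f df a b : a <= b ->
    (forall x, a <= x <= b -> is_derive x 1 f (df x)) ->
    (forall x, a <= x <= b -> df x <= 0) -> f b <= f a.
Proof.
move=> ab fdf df0; rewrite -lerN2.
apply: (@is_derive_ge0_le (fun x => - f x) (fun x => - df x)) => // x xab.
  by apply: is_deriveN; exact: fdf.
by rewrite oppr_ge0 df0.
Qed.

Lemma ln_le_subr1 x : 0 < x -> ln x <= x - 1.
Proof.
by move=> x0; rewrite -{1}(subrKC 1 x) le_ln1Dx// ltrBrDl subrr.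
Qed.

Lemma is_derive_mulln x : 0 < x ->
  is_derive x 1 (fun y => y * ln y) (ln x + 1).
Proof.
move=> x0; have lnx := is_derive1_ln x0.
have -> : ln x + 1 = x *: x^-1 + ln x *: (1 : R).
  by rewrite /GRing.scale/= mulfV ?gt_eqF// mulr1 addrC.
exact: is_deriveM.
Qed.

Let psi u : R := u * ln u - u + 1 - (u - 1) ^+ 2 / 2.

Let is_derive_psi u : 0 < u -> is_derive u 1 psi (ln u - (u - 1)).
Proof.
move=> u0; have xlnx := is_derive_mulln u0.
rewrite /psi; apply: is_derive_eq.
rewrite /GRing.scale/=; lra.
Qed.

(** [u * ln u - u + 1] is the error of the tangent of u ln u at 1, that is (u - 1)^2 / (2 xi) with
    xi between 1 and u. The four bounds ending with [mulln_le_sqr_div] replace xi by its extreme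
    values. *)
Lemma mulln_ge_sqr u : 0 < u -> u <= 1 -> (u - 1) ^+ 2 / 2 <= u * ln u - u + 1.
Proof.
move=> u0 u1; rewrite -subr_ge0 -/(psi u).
suff : psi 1 <= psi u by rewrite /psi ln1; lra.
apply: (is_derive_le0_le u1 (df := fun u => ln u - (u - 1))) => x /andP[ux x1].
  by apply: is_derive_psi; lra.
by have := @ln_le_subr1 x; lra.
Qed.

Lemma mulln_le_sqr u : 1 <= u -> u * ln u - u + 1 <= (u - 1) ^+ 2 / 2.
Proof.
move=> u1; rewrite -subr_le0 -/(psi u).
suff : psi u <= psi 1 by rewrite /psi ln1; lra.
apply: (is_derive_le0_le u1 (df := fun u => ln u - (u - 1))) => x /andP[ux x1].
  by apply: is_derive_psi; lra.
by have := @ln_le_subr1 x; lra.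
Qed.

Let chi u : R := u - 1 - ln u - (u - 1) ^+ 2 / 2.

Let is_derive_chi u : 0 < u -> is_derive u 1 chi (- (u - 1) ^+ 2 / u).
Proof.
move=> u0; have lnx := is_derive1_ln u0.
rewrite /chi; apply: is_derive_eq.
rewrite /GRing.scale/=; field; exact: lt0r_neq0.
Qed.

Let chi_nincr a b : 0 < a -> a <= b -> chi b <= chi a.
Proof.
move=> a0 ab.
apply: (is_derive_le0_le ab (df := fun u => - (u - 1) ^+ 2 / u)) => x /andP[ax xb].
  by apply: is_derive_chi; lra.
by rewrite /= mulNr oppr_le0 divr_ge0 ?sqr_ge0//; lra.
Qed.

(** Passing from u to 1/u turns the tangent error of u ln u into that of - ln, so the bounds with
    denominator 2 u follow from the monotonicity of [chi]. *)
Let mulln_chi u : 0 < u -> u * ln u - u + 1 = u * (u^-1 - 1 - ln u^-1).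
Proof. move=> u0; rewrite lnV ?posrE//; field; exact: lt0r_neq0. Qed.

Let sqrV u : 0 < u -> u * ((u^-1 - 1) ^+ 2 / 2) = (u - 1) ^+ 2 / (2 * u).
Proof. move=> u0; field; exact: lt0r_neq0. Qed.

Lemma mulln_ge_sqr_div u : 1 <= u ->
  (u - 1) ^+ 2 / (2 * u) <= u * ln u - u + 1.
Proof.
move=> u1; have u0 : 0 < u by lra.
rewrite mulln_chi// -sqrV// ler_wpM2l ?(ltW u0)// -subr_ge0 -/(chi _).
have := @chi_nincr u^-1 1; rewrite invr_gt0 invf_le1// /chi ln1; lra.
Qed.

Lemma mulln_le_sqr_div u : 0 < u -> u <= 1 ->
  u * ln u - u + 1 <= (u - 1) ^+ 2 / (2 * u).
Proof.
move=> u0 u1.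
rewrite mulln_chi// -sqrV// ler_wpM2l ?(ltW u0)// -subr_le0 -/(chi _).
have := @chi_nincr 1 u^-1; rewrite invf_ge1// /chi ln1; lra.
Qed.

Let mulln_scale x b : 0 < b ->
  x * ln (x / b) - (x - b) = b * (x / b * ln (x / b) - x / b + 1).
Proof. by move=> b0; field; exact: lt0r_neq0. Qed.

(** The right-hand side is the Bregman divergence of x ln x, equal to (x - b)^2 / (2 xi) with xi
    between x and b. The two conditions on [K] say that 1 / (2 xi) is at least [K] at both ends. *)
Lemma mulln_div_ge x b K : 0 <= x -> 0 < b -> 0 <= K ->
  2 * K * x <= 1 -> 2 * K * b <= 1 -> K * (x - b) ^+ 2 <= x * ln (x / b) - (x - b).
Proof.
rewrite le_eqVlt => /predU1P[<- b0 K0 _|x0 b0 K0 Kx] Kb.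
  rewrite mul0r !sub0r opprK sqrrN; have := ler_wpM2l (ltW b0) Kb; nra.
have xb0 : 0 < x / b by rewrite divr_gt0.
rewrite mulln_scale//; have [xb|/ltW bx] := leP (x / b) 1.
  apply: le_trans (ler_wpM2l (ltW b0) (mulln_ge_sqr xb0 xb)).
  have -> : b * ((x / b - 1) ^+ 2 / 2) = (2 * b)^-1 * (x - b) ^+ 2.
    by field; exact: lt0r_neq0.
  by rewrite ler_wpM2r ?sqr_ge0// -div1r ler_pdivlMr ?mulr_gt0//; lra.
apply: le_trans (ler_wpM2l (ltW b0) (mulln_ge_sqr_div bx)).
have -> : b * ((x / b - 1) ^+ 2 / (2 * (x / b))) = (2 * x)^-1 * (x - b) ^+ 2.
  by field; rewrite !lt0r_neq0.
by rewrite ler_wpM2r ?sqr_ge0// -div1r ler_pdivlMr ?mulr_gt0//; lra.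
Qed.

Lemma mulln_div_le x b K : 0 < x -> 0 < b ->
  1 <= 2 * K * x -> 1 <= 2 * K * b -> x * ln (x / b) - (x - b) <= K * (x - b) ^+ 2.
Proof.
move=> x0 b0 Kx Kb; have xb0 : 0 < x / b by rewrite divr_gt0.
rewrite mulln_scale//; have [xb|/ltW bx] := leP (x / b) 1.
  apply: le_trans (ler_wpM2l (ltW b0) (mulln_le_sqr_div xb0 xb)) _.
  have -> : b * ((x / b - 1) ^+ 2 / (2 * (x / b))) = (2 * x)^-1 * (x - b) ^+ 2.
    by field; rewrite !lt0r_neq0.
  by rewrite ler_wpM2r ?sqr_ge0// -div1r ler_pdivrMr ?mulr_gt0//; lra.
apply: le_trans (ler_wpM2l (ltW b0) (mulln_le_sqr bx)) _.
have -> : b * ((x / b - 1) ^+ 2 / 2) = (2 * b)^-1 * (x - b) ^+ 2.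
  by field; exact: lt0r_neq0.
by rewrite ler_wpM2r ?sqr_ge0// -div1r ler_pdivrMr ?mulr_gt0//; lra.
Qed.

(** Multiplication by 1 + v turns the left side into u ln u, which is at most v + v^2 / 2 for v >= 0
    and at most v + v^2 / (2 (1 + v)) for v <= 0. *)
Lemma ln1D_le v : `|v| <= 2^-1 -> ln (1 + v) <= v - v ^+ 2 / 2 + `|v| ^+ 3.
Proof.
move=> vh; have u0 : 0 < 1 + v by move: vh; rewrite ler_norml; lra.
have uV : (1 + v) / (1 + v) = 1 by rewrite mulfV ?gt_eqF.
have [v0|/ltW v0] := leP 0 v.
  rewrite ger0_norm// in vh *; have := @mulln_le_sqr (1 + v).
  move=> h; have {}h := h ltac:(lra).
  rewrite -(ler_pM2l u0); apply: (@le_trans _ _ (v + v ^+ 2 / 2)); first nra.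
  rewrite -subr_ge0.
  have -> : (1 + v) * (v - v ^+ 2 / 2 + v ^+ 3) - (v + v ^+ 2 / 2) =
    v ^+ 3 * (2^-1 + v) by field.
  by rewrite mulr_ge0 ?exprn_ge0//; lra.
rewrite ler0_norm// in vh *; have := @mulln_le_sqr_div (1 + v) u0.
move=> h; have {}h := h ltac:(lra).
rewrite -(ler_pM2l u0); apply: (@le_trans _ _ (v + v ^+ 2 / (2 * (1 + v)))).
  move: h; have -> : 1 + v - 1 = v by lra.
  lra.
rewrite -subr_ge0.
have -> : (1 + v) * (v - v ^+ 2 / 2 + (- v) ^+ 3) - (v + v ^+ 2 / (2 * (1 + v))) =
    (- v) ^+ 3 * (2 * (- v) - 1) * (- v - 2) / (2 * (1 + v)).
  by field; rewrite gt_eqF.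
apply: divr_ge0; last lra.
rewrite -mulrA mulr_ge0 ?exprn_ge0//; first lra.
by rewrite mulr_le0//; lra.
Qed.

End real_inequalities.

Section two_point.
Context (R : realType).
Implicit Types a p x z : R.

Let is_derive_inv (f : R -> R) df x : f x != 0 -> is_derive x 1 f df ->
  is_derive x 1 (fun y => (f y)^-1) (- f x ^- 2 * df).
Proof.
move=> fx0 [dfx <-]; apply: DeriveDef; first exact: derivableV.
by rewrite deriveV.
Qed.

(** At x = q - 1 this bound, times 2 (q - 1) / (q - 2), is exactly q; it yields [zeta_le]. *)
Lemma ln_le_half x : 1 <= x -> ln x <= (x - x^-1) / 2.
Proof.
move=> x1; rewrite -subr_ge0.
pose f (y : R) : R := (y - y^-1) / 2 - ln y.
suff : f 1 <= f x by rewrite /f ln1 invr1 subrr mul0r subrr.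
apply: (is_derive_ge0_le x1 (df := fun y => (y - 1) ^+ 2 / (2 * y ^+ 2))).
  move=> y /andP[y1 _]; have y0 : 0 < y by lra.
  have lny := is_derive1_ln y0; have y00 : y != 0 by rewrite gt_eqF.
  have invy := is_derive_inv y00 (is_derive_id _ _).
  rewrite /f; apply: is_derive_eq.
  rewrite /GRing.scale/=; field; exact: lt0r_neq0.
by move=> y _; rewrite divr_ge0 ?sqr_ge0// mulr_ge0 ?sqr_ge0.
Qed.

(** At x = q - 1 this bound, times 2 (q - 1) / (q - 2), is exactly 4 (q - 1) / q; it yields
    [zeta_ge]. *)
Lemma ln_ge_pade x : 1 <= x -> 2 * (x - 1) / (x + 1) <= ln x.
Proof.
move=> x1; rewrite -subr_ge0.
pose f (y : R) : R := ln y - 2 * (y - 1) / (y + 1).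
suff : f 1 <= f x by rewrite /f ln1 subrr mulr0 mul0r subrr.
apply: (is_derive_ge0_le x1 (df := fun y => (y - 1) ^+ 2 / (y * (y + 1) ^+ 2))).
  move=> y /andP[y1 _]; have y0 : 0 < y by lra.
  have y10 : y + 1 != 0 by rewrite gt_eqF//; lra.
  have lny := is_derive1_ln y0.
  have invy := @is_derive_inv (fun z => z + 1) _ y y10
    (is_deriveD (is_derive_id _ _) (is_derive_cst _ _ _)).
  rewrite /f; apply: is_derive_eq.
  rewrite /GRing.scale/=; field; by rewrite y10 lt0r_neq0.
by move=> y /andP[y1 _]; rewrite divr_ge0 ?sqr_ge0// mulr_ge0 ?sqr_ge0//; lra.
Qed.

Let logit a : R := ln a - ln (1 - a).

Let is_derive_ln1B a : a < 1 -> is_derive a 1 (fun z => ln (1 - z)) (- (1 - a)^-1).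
Proof.
move=> a1; have ln1a : is_derive (1 - a) 1 (@ln R) (1 - a)^-1.
  by apply: is_derive1_ln; rewrite subr_gt0.
rewrite -mulrN1; apply: (@is_derive1_comp _ (@ln R) (fun z => 1 - z)).
by apply: is_derive_eq; rewrite add0r mul1r.
Qed.

Let is_derive_logit a : 0 < a -> a < 1 -> is_derive a 1 logit (a * (1 - a))^-1.
Proof.
move=> a0 a1; have lna := is_derive1_ln a0; have ln1a := is_derive_ln1B a1.
rewrite /logit; apply: is_derive_eq; field.
by rewrite subr_eq0 eq_sym lt_eqF ?gt_eqF.
Qed.

(** Later [a0] is (q - 1) / q and [C] is zeta_q q / (2 (q - 1)). [logit_a0] says that [a0] is a
    critical point of [phi] below, whose derivative is [k]; [C_le2] is the second-order condition
    for the case where the critical points [a0] and 1 - [a0] merge at 1/2. *)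
Variables (C a0 : R).
Hypotheses (a0_ge : 1 <= 2 * a0) (a0_lt1 : a0 < 1).
Hypothesis logit_a0 : ln (a0 / (1 - a0)) = C * (2 * a0 - 1).
Hypothesis C_le2 : 2 * a0 = 1 -> C <= 2.

(* [logit - C (2 a - 1)] is convex on [1/2, 1) and vanishes at [1/2] and [a0]. *)
Let k a : R := logit a - C * (2 * a - 1).
Let dk a : R := (a * (1 - a))^-1 - 2 * C.

Let is_derive_k a : 0 < a -> a < 1 -> is_derive a 1 k (dk a).
Proof.
move=> a00 a1; have lgt := is_derive_logit a00 a1; rewrite /k /dk; apply: is_derive_eq.
rewrite /GRing.scale/=; ring.
Qed.

Let dk_nondecr a b : 1 <= 2 * a -> a <= b -> b < 1 -> dk a <= dk b.
Proof.
move=> a2 ab b1; rewrite /dk lerD2r lef_pV2 ?posrE ?mulr_gt0 ?subr_gt0//; nra.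
Qed.

Let k_half : k 2^-1 = 0.
Proof.
rewrite /k /logit; have -> : 1 - 2^-1 = 2^-1 :> R by lra.
rewrite subrr; lra.
Qed.

Let k_a0 : k a0 = 0.
Proof.
have a00 : 0 < a0 by have := a0_ge; lra.
by rewrite /k -logit_a0 ln_div ?posrE ?subr_gt0// subrr.
Qed.

Let k_le0 a : 1 <= 2 * a -> a <= a0 -> k a <= 0.
Proof.
have [h1 h2] := (a0_ge, a0_lt1).
move=> a2 aa0.
have [|x xa0|c c1 kc] := @is_derive_MVT R k dk 2^-1 a; first lra.
  by apply: is_derive_k; lra.
have [|x xa0|d d1 kd] := @is_derive_MVT R k dk a a0; first lra.
  by apply: is_derive_k; lra.
have cd : dk c <= dk d by apply: dk_nondecr; lra.
rewrite k_half subr0 in kc; rewrite k_a0 sub0r in kd.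
rewrite leNgt; apply/negP => ka.
have dc : 0 < dk c.
  rewrite ltNge; apply/negP => dc; move: ka; rewrite kc ltNge mulr_le0_ge0//.
  by lra.
have : 0 <= dk d * (a0 - a) by rewrite mulr_ge0//; lra.
lra.
Qed.

Let k_ge0 a : a0 <= a -> a < 1 -> 0 <= k a.
Proof.
have [h1 h2] := (a0_ge, a0_lt1).
move=> a0a a1.
have [|x xa0|c c1 kc] := @is_derive_MVT R k dk 2^-1 a0; first lra.
  by apply: is_derive_k; lra.
have [|x xa0|d d1 kd] := @is_derive_MVT R k dk a0 a; first lra.
  by apply: is_derive_k; lra.
have cd : dk c <= dk d by apply: dk_nondecr; lra.
rewrite k_half k_a0 subrr in kc; rewrite k_a0 subr0 in kd.
rewrite kd; apply: mulr_ge0; last by rewrite subr_ge0.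
apply: le_trans cd.
have [a0h|a0h] := eqVneq (2 * a0) 1.
  have -> : c = 2^-1 by lra.
  have -> : dk 2^-1 = 4 - 2 * C.
    rewrite /dk; have -> : 1 - 2^-1 = 2^-1 :> R by lra.
    rewrite -invfM invrK; lra.
  have := C_le2 a0h; lra.
move/esym/eqP: kc; rewrite mulf_eq0 => /orP[/eqP->//|/eqP].
by move/eqP: a0h; lra.
Qed.

Let phi a : R := a * ln a + (1 - a) * ln (1 - a) + C * (a * (1 - a)).

Let is_derive_phi a : 0 < a -> a < 1 -> is_derive a 1 phi (k a).
Proof.
move=> a00 a1; have lna := is_derive1_ln a00; have ln1a := is_derive_ln1B a1.
rewrite /phi /k /logit; apply: is_derive_eq.
rewrite /GRing.scale/=; field.
by rewrite subr_eq0 eq_sym lt_eqF ?gt_eqF.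
Qed.

Let phi_ge_lt1 a : 1 <= 2 * a -> a < 1 -> phi a0 <= phi a.
Proof.
have [h1 h2] := (a0_ge, a0_lt1).
move=> a2 a1; have [aa0|/ltW a0a] := leP a a0.
  apply: (is_derive_le0_le aa0) => x /andP[ax xa0].
    by apply: is_derive_phi; lra.
  by apply: k_le0; lra.
apply: (is_derive_ge0_le a0a) => x /andP[ax xa0].
  by apply: is_derive_phi; lra.
by apply: k_ge0; lra.
Qed.

(** The endpoint is reached by approximation, as [phi] is not differentiable there. *)
Let phi1 : phi a0 <= phi 1.
Proof.
have [h1 h2] := (a0_ge, a0_lt1).
have phiE1 : phi 1 = 0 by rewrite /phi ln1; lra.
rewrite phiE1; have [//|phi0] := leP (phi a0) 0.
(* The entropy terms are nonpositive, so [phi (1 - e)] is at most |C| e. This [e] makes |C| e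
   smaller than [phi a0], against the bound already proved at 1 - e. *)
pose e := Num.min (2^-1) (phi a0 / (2 * (`|C| + 1))).
have C1 : 0 < 2 * (`|C| + 1) by rewrite mulr_gt0// ltr_wpDl.
have e0 : 0 < e by rewrite lt_min invr_gt0 ltr0n/= divr_gt0.
have eh : e <= 2^-1 by rewrite ge_min lexx.
have eC : e * (2 * (`|C| + 1)) <= phi a0.
  by rewrite -ler_pdivlMr// ge_min lexx orbT.
have := @phi_ge_lt1 (1 - e); rewrite /phi.
have -> : 1 - (1 - e) = e by lra.
have l1 := @ln_le0 R (1 - e); have l2 := @ln_le0 R e.
have : C <= `|C| by exact: ler_norm.
move=> CC ph; have {}ph := ph ltac:(lra) ltac:(lra).
have {}l1 := l1 ltac:(lra); have {}l2 := l2 ltac:(lra).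
have p1 : (1 - e) * ln (1 - e) <= 0 by nra.
have p2 : e * ln e <= 0 by nra.
have p3 : C * ((1 - e) * e) <= `|C| * e.
  have e1 : 0 <= (1 - e) * e by rewrite mulr_ge0; lra.
  have := ler_wpM2l e1 CC; have := mulr_ge0 (sqr_ge0 e) (normr_ge0 C); lra.
rewrite -/(phi a0) in ph; lra.
Qed.

Lemma binary_entropy_ge a : 0 <= a <= 1 ->
  a0 * ln a0 + (1 - a0) * ln (1 - a0) + C * (a0 * (1 - a0)) <=
  a * ln a + (1 - a) * ln (1 - a) + C * (a * (1 - a)).
Proof.
move=> /andP[a00 a1]; rewrite -!/(phi _).
have phi_sym b : phi (1 - b) = phi b.
  by rewrite /phi subKr; lra.
wlog a2 : a a00 a1 / 1 <= 2 * a.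
  move=> h; have [|/ltW a2] := leP 1 (2 * a); first exact: h.
  by rewrite -(phi_sym a); apply: h; lra.
move: a1; rewrite le_eqVlt => /predU1P[->//|]; exact: phi_ge_lt1.
Qed.

End two_point.

Section zeta.
Context (R : realType) (q : nat) (q1 : (1 < q)%N).
Implicit Types a x : R.
Let Q : R := q%:R.
Let p : R := Q - 1.

Let Q_ge2 : 2 <= Q. Proof. by rewrite ler_nat. Qed.

Let C : R := zeta R q * Q / (2 * p).

Let C_q2 : Q = 2 -> C = 2.
Proof.
move=> Q2; have /eqP q2 : q == 2%N by rewrite -(eqr_nat R) -Q2.
by rewrite /C /zeta /p Q2 q2/=; field.
Qed.

(** For q >= 3 this identity determines zeta_q: it cancels the term linear in [a] in the difference
    of the two sides of [two_point_ge], which leaves a function symmetric under the exchange of a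
    and 1 - a. For q = 2 it reads 0 = 0, and [C_q2] supplies the value instead. *)
Let C_mul : C * (p - 1) = Q * ln p.
Proof.
have [q2|q3] := leqP q 2.
  have Q2 : Q = 2 by apply/eqP; rewrite eq_le Q_ge2 ler_nat q2.
  by rewrite /p Q2 (_ : 2 - 1 = 1) ?ln1; lra.
have Q3 : 3 <= Q by rewrite ler_nat.
rewrite /C /zeta leqNgt q3/= -/Q -/p.
have -> : Q - 2 = p - 1 by rewrite /p; lra.
by field; apply/andP; split; rewrite gt_eqF// /p; lra.
Qed.

Lemma mulln_mul c x : 0 < c -> 0 <= x -> x * ln (c * x) = x * ln c + x * ln x.
Proof.
move=> c0; rewrite le_eqVlt => /predU1P[<-|x0]; first by rewrite !mul0r addr0.
by rewrite lnM ?posrE// mulrDr.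
Qed.

(** One colour has mass [a] and the others share the rest evenly. The left side equals C (a -
    1/q)^2, and the difference of the sides is the function minimised in [binary_entropy_ge] minus
    its minimum, so equality holds at 1/q and at (q - 1) / q. *)
Lemma two_point_ge a : 0 <= a <= 1 ->
  zeta R q / 2 * ((a - Q^-1) ^+ 2 + p * ((1 - a) / p - Q^-1) ^+ 2) <=
  a * ln (Q * a) + (1 - a) * ln (Q * ((1 - a) / p)).
Proof.
move=> a01; have Q2 := Q_ge2; have pE : p = Q - 1 by [].
have p0 : 0 < p by rewrite pE; lra.
have Q0 : 0 < Q by lra.
have p00 : p != 0 by rewrite gt_eqF.
have Q00 : Q != 0 by rewrite gt_eqF.
have a0B : 1 - p / Q = Q^-1 by rewrite pE; field.
have lnp : ln p = C * (p - 1) / Q by rewrite C_mul; field.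
have a0_ge : 1 <= 2 * (p / Q) by rewrite mulrA ler_pdivlMr// pE; lra.
have a0_lt1 : p / Q < 1 by rewrite ltr_pdivrMr// pE; lra.
have logit_a0 : ln (p / Q / (1 - p / Q)) = C * (2 * (p / Q) - 1).
  by rewrite a0B invrK divfK// lnp pE; field.
have C_le2 : 2 * (p / Q) = 1 -> C <= 2.
  move=> pQ; rewrite C_q2//; have := mulfK Q00 p; rewrite -mulrA mulrCA; nra.
have := binary_entropy_ge a0_ge a0_lt1 logit_a0 C_le2 a01.
rewrite a0B ln_div ?posrE// lnV ?posrE// lnp.
have -> : a * ln (Q * a) = a * ln Q + a * ln a.
  by rewrite mulln_mul//; lra.
have -> : (1 - a) * ln (Q * ((1 - a) / p)) =
    (1 - a) * (ln Q - ln p) + (1 - a) * ln (1 - a).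
  have -> : Q * ((1 - a) / p) = Q / p * (1 - a) by field.
  by rewrite mulln_mul ?ln_div ?posrE ?divr_gt0//; lra.
have -> : zeta R q / 2 = C * p / Q by rewrite /C; field; rewrite p00 Q00.
rewrite lnp => h.
have -> : C * p / Q * ((a - Q^-1) ^+ 2 + p * ((1 - a) / p - Q^-1) ^+ 2) =
    p / Q * (C * (p - 1) / Q - ln Q) + Q^-1 * - ln Q + C * (p / Q * Q^-1)
    + ln Q - (1 - a) * (C * (p - 1) / Q) - C * (a * (1 - a)).
  by rewrite pE; field; rewrite Q00 -pE p00.
lra.
Qed.

(** Places 1/q below the inflection point 1/zeta_q of the entropy summand, and keeps q - mu positive
    for every mu below zeta_q. *)
Lemma zeta_le : zeta R q <= Q.
Proof.
have Q2 := Q_ge2; rewrite /zeta; case: ifP => // q2.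
have Q3 : 3 <= Q by rewrite ler_nat ltnNge q2.
have p0 : 0 < p by rewrite /p; lra.
have : ln p <= (p - p^-1) / 2 by apply: ln_le_half; rewrite /p; lra.
rewrite -/Q -/p => lnp; have Q20 : 0 < Q - 2 by lra.
have k0 : 0 <= 2 * (p / (Q - 2)) by rewrite mulr_ge0// divr_ge0// ltW.
apply: le_trans (ler_wpM2l k0 lnp) _.
have -> : 2 * (p / (Q - 2)) * ((p - p^-1) / 2) = Q => //.
by rewrite /p; field; rewrite -/p !gt_eqF.
Qed.

Lemma zeta_ge : 4 * ((Q - 1) / Q) <= zeta R q.
Proof.
have Q2 := Q_ge2; rewrite /zeta; case: ifP => // q2.
  have -> : Q = 2 by apply/eqP; rewrite eq_le Q_ge2 ler_nat q2.
  by lra.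
have Q3 : 3 <= Q by rewrite ler_nat ltnNge q2.
have p0 : 0 < p by rewrite /p; lra.
have : 2 * (p - 1) / (p + 1) <= ln p by apply: ln_ge_pade; rewrite /p; lra.
rewrite -/Q -/p => lnp; have Q20 : 0 < Q - 2 by lra.
have k0 : 0 <= 2 * (p / (Q - 2)) by rewrite mulr_ge0// divr_ge0// ltW.
apply: le_trans (ler_wpM2l k0 lnp).
have -> : 2 * (p / (Q - 2)) * (2 * (p - 1) / (p + 1)) = 4 * (p / Q) => //.
by rewrite /p; field; rewrite !gt_eqF//; lra.
Qed.

Lemma zeta_gt0 : 0 < zeta R q.
Proof.
apply: lt_le_trans zeta_ge; have Q2 := Q_ge2.
by rewrite mulr_gt0// divr_gt0//; lra.
Qed.

End zeta.

Section relative_entropy.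
Context (R : realType) (q : nat).
Implicit Types (x : 'I_q -> R) (a b y z K : R).

Definition relent x : R := \sum_c x c * ln (q%:R * x c).

Hypothesis q1 : (1 < q)%N.
Let Q : R := q%:R.

Let Q_ge2 : 2 <= Q. Proof. by rewrite ler_nat. Qed.
Let Q_gt0 : 0 < Q. Proof. by have := Q_ge2; lra. Qed.

(** The second derivative 1/y - 2 K changes sign at 1 / (2 K), so [H K] is convex before this point
    and concave after it. *)
Let H K y : R := y * ln (Q * y) - K * (y - Q^-1) ^+ 2.
Let dH K y : R := ln (Q * y) + 1 - 2 * K * (y - Q^-1).

Let H_taylor K y b : 0 <= y -> 0 < b ->
  H K y - H K b - dH K b * (y - b) = y * ln (y / b) - (y - b) - K * (y - b) ^+ 2.
Proof.
move=> y0 b0; rewrite /H /dH !mulln_mul// ?(ltW b0)//.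
rewrite [y / b]mulrC mulln_mul ?invr_gt0// lnV ?posrE// lnM ?posrE//; lra.
Qed.

Let H_tangent K y b : 0 <= y -> 0 < b -> 0 <= K -> 2 * K * y <= 1 ->
  2 * K * b <= 1 -> H K b + dH K b * (y - b) <= H K y.
Proof.
move=> y0 b0 K0 Ky Kb.
have := mulln_div_ge y0 b0 K0 Ky Kb; have := H_taylor K y0 b0; lra.
Qed.

(** Beyond the inflection point the tangent at [z] lies above the graph at [t] and at [a]; with the
    weights a - z and z - t its slope cancels, which puts the chord below [H K z]. *)
Let H_chord K t a z : 0 < t -> 1 <= 2 * K * t -> t < a -> t <= z -> z <= a ->
  0 <= K -> H K t + (z - t) * ((H K a - H K t) / (a - t)) <= H K z.
Proof.
move=> t0 Kt ta tz za K0.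
have z0 : 0 < z by lra.
have a0 : 0 < a by lra.
have Kz : 1 <= 2 * K * z by nra.
have Ka : 1 <= 2 * K * a by nra.
have ht := mulln_div_le t0 z0 Kt Kz; have := H_taylor K (ltW t0) z0.
have ha := mulln_div_le a0 z0 Ka Kz; have := H_taylor K (ltW a0) z0.
move=> ea et.
have at0 : 0 < a - t by lra.
have at0' : a - t != 0 by rewrite gt_eqF.
rewrite -(ler_pM2r at0) mulrDl.
have -> : (z - t) * ((H K a - H K t) / (a - t)) * (a - t) =
   (z - t) * (H K a - H K t) by field.
have h1 : (z - t) * (H K a - H K z - dH K z * (a - z)) <= 0.
  by rewrite mulr_ge0_le0//; lra.
have h2 : (a - z) * (H K t - H K z - dH K z * (t - z)) <= 0.
  by rewrite mulr_ge0_le0//; lra.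
lra.
Qed.

Lemma relent_ge_small K x : (forall c, 0 <= x c) -> \sum_c x c = 1 -> 0 <= K ->
    2 * K <= Q -> (forall c, 2 * K * x c <= 1) ->
  K * \sum_c (x c - Q^-1) ^+ 2 <= relent x.
Proof.
move=> x0 x1 K0 KQ Kx; rewrite -subr_ge0 mulr_sumr -sumrB.
have QV0 : 0 < Q^-1 by rewrite invr_gt0.
have tang c : dH K Q^-1 * (x c - Q^-1) <= H K (x c).
  have := H_tangent (x0 c) QV0 K0 (Kx _).
  rewrite {1}/H subrr expr0n mulr0 mulfV ?gt_eqF// ln1 mulr0 subr0 add0r.
  by apply; rewrite ler_pdivrMr// mul1r.
apply: le_trans (ler_sum _ (fun c _ => tang c)).
rewrite -mulr_sumr sumrB x1 sumr_const card_ord -[_ *+ _]mulr_natr.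
by rewrite mulVf ?gt_eqF// subrr mulr0.
Qed.

(** The constant is the largest K with 2 K (1/q + d) <= 1, and it tends to q / 2 as [d] tends to
    0. *)
Lemma relent_ge_near d x : (forall c, 0 <= x c) -> \sum_c x c = 1 -> 0 <= d ->
    (forall c, `|x c - Q^-1| <= d) ->
  Q / 2 / (1 + Q * d) * \sum_c (x c - Q^-1) ^+ 2 <= relent x.
Proof.
move=> x0 x1 d0 xd; have Qd : 0 < 1 + Q * d.
  by rewrite ltr_pwDl// mulr_ge0// ltW.
have KE : 2 * (Q / 2 / (1 + Q * d)) = Q / (1 + Q * d) by field; rewrite gt_eqF.
apply: relent_ge_small => //.
- by rewrite !divr_ge0 ?ltW.
- by rewrite KE ler_pdivrMr// ler_peMr ?(ltW Q_gt0)// lerDl mulr_ge0// ltW.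
move=> c; rewrite KE mulrAC ler_pdivrMr// mul1r.
have := ler_wpM2l (ltW Q_gt0) (le_trans (ler_norm _) (xd c)).
by rewrite mulrBr mulfV ?gt_eqF//; lra.
Qed.

(* On (1/zeta, 1] the summand [H] is concave, so mass is pushed onto a single
   colour [c0]; on [0, 1/zeta] it is convex, so the other colours are averaged. *)
Lemma relent_ge x : (forall c, 0 <= x c) -> \sum_c x c = 1 ->
  zeta R q / 2 * \sum_c (x c - Q^-1) ^+ 2 <= relent x.
Proof.
move=> x0 x1; set K := zeta R q / 2.
have K0 : 0 < K by rewrite divr_gt0// zeta_gt0.
pose t := (2 * K)^-1.
have t0 : 0 < t by rewrite invr_gt0 mulr_gt0.
have Kt : 2 * K * t = 1 by rewrite mulfV// gt_eqF// mulr_gt0.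
have KQ : 2 * K <= Q by rewrite mulrC divfK// zeta_le.
have Qt : Q^-1 <= t by rewrite lef_pV2// posrE mulr_gt0.
have Ky y : y <= t -> 2 * K * y <= 1 by move=> yt; nra.
have QV0 : 0 < Q^-1 by rewrite invr_gt0.
have sumHE : relent x - K * \sum_c (x c - Q^-1) ^+ 2 = \sum_c H K (x c).
  by rewrite mulr_sumr -sumrB.
rewrite -subr_ge0 sumHE.
case: (pickP (fun c => t < x c)) => [c0 c0t|small]; last first.
  rewrite -sumHE subr_ge0; apply: relent_ge_small => //; first exact: ltW.
  by move=> c; rewrite Ky// leNgt small.
(* Mass above the inflection point [t] is cut off from the other colours and given to [c0], which
   then carries [a]. *)
pose y c := Num.min (x c) t.
have y0 c : 0 <= y c by rewrite le_min x0 ltW.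
have yt c : y c <= t by rewrite ge_min lexx orbT.
have yx c : y c <= x c by rewrite ge_min lexx.
pose a := 1 - \sum_(c | c != c0) y c.
have aE : a = x c0 + \sum_(c | c != c0) (x c - y c).
  by rewrite /a -x1 (bigD1 c0)//= sumrB addrA.
have xa c : x c - y c + t <= a \/ c = c0.
  have [->|cc0] := eqVneq c c0; [by right|left].
  rewrite aE (bigD1 c)//=.
  have : 0 <= \sum_(i | (i != c0) && (i != c)) (x i - y i).
    by apply: sumr_ge0 => i _; rewrite subr_ge0.
  by lra.
have c0a : x c0 <= a.
  by rewrite aE lerDl sumr_ge0// => c _; rewrite subr_ge0.
have ta : t < a by exact: lt_le_trans c0a.
have a1 : a <= 1 by rewrite /a lerBlDr lerDl sumr_ge0.
(* Slope of the chord over [t, a]. The excesses over [t] of all colours above it, [c0] included, add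
   up to a - t, so the chord estimates sum to exactly H a - H t. *)
pose s := (H K a - H K t) / (a - t).
have chord c : c != c0 -> H K (y c) + (x c - y c) * s <= H K (x c).
  move=> cc0; case: (xa c) => [xca|/eqP]; last by rewrite (negPf cc0).
  have [xt|tx] := leP (x c) t.
    by rewrite /y min_l// subrr mul0r addr0.
  have yE : y c = t by rewrite /y min_r// ltW.
  rewrite yE in xca *; apply: H_chord => //; rewrite ?Kt ?(ltW tx) ?(ltW K0)//.
  by lra.
have chord0 : H K t + (x c0 - t) * s <= H K (x c0).
  by apply: H_chord; rewrite ?Kt ?(ltW c0t) ?(ltW K0).
have lower : H K a + \sum_(c | c != c0) H K (y c) <= \sum_c H K (x c).
  rewrite [leRHS](bigD1 c0)//=.
  have := ler_sum (index_enum 'I_q) chord; rewrite big_split/=.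
  have -> : \sum_(c | c != c0) (x c - y c) * s = (a - x c0) * s.
    by rewrite -mulr_suml aE [x c0 + _]addrC addrK.
  have sE : s * (a - t) = H K a - H K t.
    by rewrite /s divfK// subr_eq0 gt_eqF.
  move=> h; lra.
apply: le_trans lower.
pose p : R := Q - 1; have p0 : 0 < p by rewrite /p; have := Q_ge2; lra.
pose b := (1 - a) / p.
have pb : p * b = 1 - a by rewrite /b mulrC divfK// gt_eqF.
have sumy : \sum_(c | c != c0) y c = p * b by rewrite pb /a subKr.
have cardc0 : \sum_(c < q | c != c0) (1 : R) = p.
  have : \sum_(c < q) (1 : R) = Q by rewrite sumr_const card_ord.
  by rewrite (bigD1 c0)//= /p => <-; rewrite addrC addrK.
have b0 : 0 <= b by apply: divr_ge0; lra.
have bt : b <= t.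
  rewrite /b ler_pdivrMr// /p.
  have := ler_wpM2r (ltW Q_gt0) Qt; rewrite mulVf ?gt_eqF// => hQ.
  by lra.
have two : 0 <= H K a + p * H K b.
  have := @two_point_ge R q q1 a; rewrite -/Q -/p -/b -/K => h.
  have {}h := h ltac:(lra).
  rewrite -pb in h; rewrite /H; lra.
apply: (le_trans two); rewrite lerD2l.
(* At b = 0 the slope of y ln y is infinite and there is no tangent to use; but then every truncated
   mass vanishes. *)
move: b0; rewrite le_eqVlt => /predU1P[bE|b0].
  have yE c : c != c0 -> y c = 0.
    move=> cc0; apply/eqP; rewrite eq_le y0 andbT.
    have : \sum_(c | c != c0) y c = 0 by rewrite sumy -bE mulr0.
    rewrite (bigD1 c)//=.
    have : 0 <= \sum_(i | (i != c0) && (i != c)) y i by exact: sumr_ge0.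
    by lra.
  rewrite -bE (eq_bigr (fun=> H K 0 * 1)) ?cardc0; last first.
    by move=> c cc0; rewrite yE// mulr1.
  by rewrite -mulr_sumr cardc0 mulrC.
have tang c : c != c0 -> H K b * 1 + dH K b * (y c - b * 1) <= H K (y c).
  by move=> _; rewrite !mulr1; apply: H_tangent; rewrite ?Ky ?(ltW K0).
apply: le_trans (ler_sum _ tang).
rewrite big_split/= -!mulr_sumr sumrB -mulr_sumr cardc0 sumy; lra.
Qed.

End relative_entropy.

(** * Counting configurations and concentration *)

Section product_weights.
Context (R : realType) (s q N : nat) (bl : 'I_N -> 'I_s).
Implicit Types (w : {ffun 'I_N -> 'I_q}) (f p : 'I_s -> 'I_q -> R).

Definition frac w k c : R :=
  (block_card bl k)%:R^-1 * \sum_(i | bl i == k) (w i == c)%:R.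

Lemma sum_prod_sites (f : 'I_N -> 'I_q -> R) :
  \sum_(w : {ffun 'I_N -> 'I_q}) \prod_i f i (w i) = \prod_i \sum_c f i c.
Proof. by rewrite bigA_distr_bigA. Qed.

Lemma sum_block_const k (x : R) :
  \sum_(i | bl i == k) x = (block_card bl k)%:R * x.
Proof.
rewrite sumr_const mulr_natl /block_card; congr (_ *+ _).
by apply: eq_card => i; apply/idP/idP => [|/set_mem//]; exact: mem_set.
Qed.

Lemma frac_ge0 w k c : 0 <= frac w k c.
Proof. by rewrite mulr_ge0 ?invr_ge0// sumr_ge0. Qed.

Hypothesis bl_gt0 : forall k, (0 < block_card bl k)%N.

Let n_neq0 k : (block_card bl k)%:R != 0 :> R.
Proof. by rewrite pnatr_eq0 -lt0n. Qed.

Let block_frac w k c :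
  (block_card bl k)%:R * frac w k c = \sum_(i | bl i == k) (w i == c)%:R.
Proof. by rewrite mulVKf. Qed.

Lemma frac_sum1 w k : \sum_c frac w k c = 1.
Proof.
rewrite -mulr_sumr exchange_big/= (eq_bigr (fun=> 1)); last first.
  move=> i _; rewrite (bigD1 (w i))//= eqxx big1 ?addr0// => c.
  by rewrite eq_sym => /negPf->.
by rewrite sum_block_const mulr1 mulVf.
Qed.

Lemma sum_block_sites w k (g : 'I_q -> R) : \sum_(i | bl i == k) g (w i) =
  (block_card bl k)%:R * \sum_c frac w k c * g c.
Proof.
rewrite mulr_sumr; under [RHS]eq_bigr => c _ do rewrite mulrA block_frac mulr_suml.
rewrite exchange_big/=; apply: eq_bigr => i _.
rewrite (bigD1 (w i))//= eqxx mul1r big1 ?addr0// => c.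
by rewrite eq_sym => /negPf->; rewrite mul0r.
Qed.

Lemma sum_sites f w : \sum_i f (bl i) (w i) =
  \sum_k (block_card bl k)%:R * \sum_c frac w k c * f k c.
Proof.
rewrite (partition_big bl predT)//=; apply: eq_bigr => k _.
by rewrite -sum_block_sites; apply: eq_bigr => i /eqP->.
Qed.

Lemma frac_gt0 w i : 0 < frac w (bl i) (w i).
Proof.
rewrite mulr_gt0 ?invr_gt0 ?ltr0n// (bigD1 i)//= eqxx.
by rewrite ltr_pwDl// sumr_ge0.
Qed.

(** Colour counts in each block. They never exceed N, so [inord] loses nothing. *)
Let type w : {ffun 'I_s * 'I_q -> 'I_N.+1} :=
  [ffun kc => inord #|[pred i | (bl i == kc.1) && (w i == kc.2)]|].

Let frac_type w w' : type w = type w' -> frac w = frac w'.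
Proof.
move=> ww'; apply/funext => k; apply/funext => c; rewrite /frac; congr (_ * _).
have cardE (v : {ffun 'I_N -> 'I_q}) : \sum_(i | bl i == k) (v i == c)%:R = (type v (k, c))%:R :> R.
  rewrite (eq_bigr (fun i => if v i == c then 1 else 0)); last first.
    by move=> i _; case: eqP.
  rewrite -big_mkcondr/= sumr_const ffunE/= inordK.
    by congr (_%:R); apply: eq_card => i; rewrite inE.
  by rewrite ltnS -[leqRHS](card_ord N) max_card.
by rewrite !cardE ww'.
Qed.

(* A configuration weighs at most 1 under the product law with its own colour
   frequencies, and there are at most (N + 1)^(sq) families of frequencies. *)
Lemma sum_expR_relent_le : (0 < q)%N ->
  \sum_(w : {ffun 'I_N -> 'I_q})
     expR (\sum_k (block_card bl k)%:R * relent (frac w k)) <=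
  N.+1%:R ^+ (s * q) * q%:R ^+ N.
Proof.
move=> q0; have q0R : 0 < q%:R :> R by rewrite ltr0n.
have expE w : expR (\sum_k (block_card bl k)%:R * relent (frac w k)) =
    \prod_i (q%:R * frac w (bl i) (w i)).
  rewrite -(sum_sites (fun k c => ln (q%:R * frac w k c))) expR_sum.
  by apply: eq_bigr => i _; rewrite lnK// posrE mulr_gt0// frac_gt0.
rewrite (partition_big type predT)//=.
apply: (@le_trans _ _ (\sum_(t : {ffun 'I_s * 'I_q -> 'I_N.+1}) q%:R ^+ N)).
  apply: ler_sum => t _.
  have [w0 /eqP w0t|no] := pickP (fun w0 => type w0 == t); last first.
    by rewrite big_pred0// exprn_ge0.
  have -> : q%:R ^+ N =
      \sum_(w : {ffun 'I_N -> 'I_q}) \prod_i (q%:R * frac w0 (bl i) (w i)).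
    rewrite (sum_prod_sites (fun i c => q%:R * frac w0 (bl i) c)).
    rewrite (eq_bigr (fun=> q%:R)); first by rewrite prodr_const card_ord.
    by move=> i _; rewrite -mulr_sumr frac_sum1 mulr1.
  rewrite [leRHS](bigID (fun w => type w == t))/= ler_wpDr//.
    apply: sumr_ge0 => w _; apply: prodr_ge0 => i _.
    by rewrite mulr_ge0 ?frac_ge0// ltW.
  by apply: ler_sum => w /eqP wt; rewrite expE (@frac_type w w0)// wt.
rewrite sumr_const card_ffun card_prod !card_ord -[_ *+ _]mulr_natl natrX.
exact: lexx.
Qed.

Let expR_le_quad (x : R) : x <= 2^-1 -> expR x <= 1 + x + 2 * x ^+ 2.
Proof.
move=> x2; have x1 : 0 < 1 - x by lra.
have eN : 1 - x <= expR (- x) by exact: expR_ge1Dx.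
rewrite -[x in expR x]opprK expRN.
apply: (@le_trans _ _ (1 - x)^-1).
  by rewrite lef_pV2 ?posrE ?expR_gt0.
rewrite -div1r ler_pdivrMr// -subr_ge0.
have -> : (1 + x + 2 * x ^+ 2) * (1 - x) - 1 = x ^+ 2 * (1 - 2 * x) by ring.
by rewrite mulr_ge0 ?sqr_ge0//; lra.
Qed.

(** The centred indicator has mean zero under [r] and modulus at most 1, so only the quadratic term
    of [expR_le_quad] survives. *)
Let mgf_le (r : 'I_q -> R) c (l : R) : (forall c', 0 <= r c') ->
    \sum_c' r c' = 1 -> `|l| <= 2^-1 ->
  \sum_c' r c' * expR (l * ((c' == c)%:R - r c)) <= expR (2 * l ^+ 2).
Proof.
move=> r0 r1 l2.
have rle c' : r c' <= 1.
  by rewrite -r1 (bigD1 c')//= lerDl sumr_ge0.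
have x1 c' : `|(c' == c)%:R - r c| <= 1.
  by have := r0 c; have := rle c; rewrite ler_norml; case: eqP => _ /=; lra.
apply: (@le_trans _ _ (1 + 2 * l ^+ 2)); last exact: expR_ge1Dx.
have -> : 1 + 2 * l ^+ 2 = \sum_c' r c' *
    (1 + l * ((c' == c)%:R - r c) + 2 * l ^+ 2).
  under eq_bigr do rewrite 2![r _ * (_ + _)]mulrDr mulr1.
  rewrite !big_split/= -mulr_suml r1 mul1r.
  suff -> : \sum_c' r c' * (l * ((c' == c)%:R - r c)) = 0 by rewrite addr0.
  under eq_bigr do rewrite mulrCA mulrBr.
  rewrite -mulr_sumr sumrB -mulr_suml r1 mul1r (bigD1 c)//= eqxx mulr1.
  by rewrite big1 ?addr0 ?subrr ?mulr0// => c' /negPf->; rewrite mulr0.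
apply: ler_sum => c' _; apply: ler_wpM2l => //.
have lx : `|l * ((c' == c)%:R - r c)| <= `|l|.
  by rewrite normrM ler_piMr.
apply: (le_trans (expR_le_quad (le_trans (ler_norm _) (le_trans lx l2)))).
rewrite lerD2l ler_pM2l// -[leLHS]real_normK ?num_real//.
by rewrite -[leRHS]real_normK ?num_real// lerXn2r// nnegrE.
Qed.

Section concentration.
Variables (p : 'I_s -> 'I_q -> R).
Hypotheses (p_ge0 : forall k c, 0 <= p k c) (p_sum1 : forall k, \sum_c p k c = 1).

Let P w : R := \prod_i p (bl i) (w i).
Let P_ge0 w : 0 <= P w. Proof. exact: prodr_ge0. Qed.

Lemma sum_prod_weight : \sum_w P w = 1.
Proof.
rewrite (sum_prod_sites (fun i c => p (bl i) c)) (eq_bigr (fun=> 1)).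
  by rewrite prodr_const expr1n.
by move=> i _; rewrite p_sum1.
Qed.

Let chernoff k c (sgn : bool) (h : R) : 0 < h -> h <= 2 ->
  \sum_(w | h < (-1) ^+ sgn * (frac w k c - p k c)) P w <=
    expR (- ((block_card bl k)%:R * h ^+ 2 / 8)).
Proof.
(* The choice |l| = h / 4 minimises - n |l| h + 2 n l^2, with value - n h^2 / 8; h <= 2 gives |l| <=
   1/2 as [mgf_le] requires. *)
move=> h0 h2; set n : R := (block_card bl k)%:R; set l := (-1) ^+ sgn * (h / 4).
have n0 : 0 <= n by [].
have lh : `|l| = h / 4.
  rewrite normrMsign ger0_norm//; lra.
pose g i c' : R :=
  p (bl i) c' * (if bl i == k then expR (l * ((c' == c)%:R - p k c)) else 1).
apply: (@le_trans _ _ (expR (- (n * (h / 4) * h)) * \prod_i \sum_c' g i c')).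
  rewrite -sum_prod_sites mulr_sumr [leRHS](bigID
    (fun w => h < (-1) ^+ sgn * (frac w k c - p k c)))/= ler_wpDr//.
    apply: sumr_ge0 => w _; rewrite mulr_ge0 ?expR_ge0//.
    by apply: prodr_ge0 => i _; rewrite mulr_ge0//; case: ifP; rewrite ?expR_ge0.
  apply: ler_sum => w hw; rewrite /g big_split/= mulrCA -[leLHS]mulr1 -/(P w).
  rewrite ler_wpM2l//.
  have -> : \prod_i (if bl i == k then expR (l * ((w i == c)%:R - p k c)) else 1) =
      expR (n * (h / 4) * ((-1) ^+ sgn * (frac w k c - p k c))).
    rewrite -big_mkcond/= -expR_sum -mulr_sumr sumrB.
    rewrite sum_block_const -block_frac -mulrBr; congr expR.
    by rewrite /l -/n; ring.
  rewrite -expRD -[leLHS]expR0 ler_expR addrC -mulrBr; apply: mulr_ge0.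
    by rewrite mulr_ge0//; lra.
  by rewrite subr_ge0 ltW.
apply: (@le_trans _ _ (expR (- (n * (h / 4) * h)) *
    \prod_i if bl i == k then expR (2 * l ^+ 2) else 1)).
  rewrite ler_wpM2l ?expR_ge0//; apply: ler_prod => i _; apply/andP; split.
    apply: sumr_ge0 => c' _; rewrite mulr_ge0//.
    by case: ifP; rewrite ?expR_ge0.
  rewrite /g; case: eqP => [->|_].
    by apply: mgf_le => //; rewrite lh; lra.
  by under eq_bigr do rewrite mulr1; rewrite p_sum1.
rewrite -big_mkcond/= -expR_sum sum_block_const -expRD ler_expR -/n.
rewrite -[l ^+ 2]real_normK ?num_real// lh; lra.
Qed.

Lemma concentration (h : 'I_s -> R) : (forall k, 0 < h k <= 2) ->
  \sum_(w | ~~ [forall k, forall c, `|frac w k c - p k c| <= h k]) P w <=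
  \sum_k \sum_(c < q) 2 * expR (- ((block_card bl k)%:R * h k ^+ 2 / 8)).
Proof.
move=> h02.
pose D k c (b : bool) w := h k < (-1) ^+ b * (frac w k c - p k c).
apply: (@le_trans _ _ (\sum_k \sum_c \sum_(b : bool) \sum_(w | D k c b w) P w)).
  rewrite pair_bigA pair_bigA/= (exchange_big_dep predT)//= [leLHS]big_mkcond/=.
  apply: ler_sum => w _; case: ifPn => [|_]; last exact: sumr_ge0.
  rewrite negb_forall => /existsP[k]; rewrite negb_forall => /existsP[c].
  rewrite -ltNge lter_normr => /orP bad.
  have [b Db] : exists b, D k c b w.
    case: bad => ?; [exists false|exists true].
      by rewrite /D expr0 mul1r.
    by rewrite /D expr1 mulN1r.
  by rewrite (bigD1 (k, c, b))//= lerDl sumr_ge0.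
apply: ler_sum => k _; apply: ler_sum => c _; rewrite big_bool/= mulr_natl mulr2n.
by have /andP[h0 h2] := h02 k; apply: lerD; exact: chernoff.
Qed.

End concentration.
End product_weights.

(** * Energy, rotation and rate function *)

Section tensor_forms.
Context (R : realType) (s n : nat).
Implicit Types (t u : 'cV[R]_(s * n)) (M : 'M[R]_s).

Definition tens_coord t (k : 'I_s) (c : 'I_n) : R := t (mxtens_index (k, c)) 0.

(** Quadratic forms with matrix [M *t 1] see a vector only through these inner products of its block
    rows. *)
Definition gram (y : 'I_s -> 'I_n -> R) j k : R := \sum_c y j c * y k c.

Lemma sum_mxtens (F : 'I_(s * n) -> R) :
  \sum_i F i = \sum_k \sum_c F (mxtens_index (k, c)).
Proof.
rewrite pair_bigA/= (reindex (@mxtens_index s n))/=.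
  by apply: eq_bigr => -[k c].
exists (@mxtens_unindex s n) => i _; [exact: mxtens_indexK|exact: mxtens_unindexK].
Qed.

Lemma tens_coord_mul m (M : 'M[R]_(m, s)) (t : 'cV[R]_(s * n)) j c :
  ((M *t (1%:M : 'M[R]_n)) *m t) (mxtens_index (j, c)) 0 =
  \sum_k M j k * tens_coord t k c.
Proof.
rewrite mxE sum_mxtens; apply: eq_bigr => k _.
rewrite (bigD1 c)//= tensmxE mxE eqxx mulr1 big1 ?addr0// => c' c'c.
by rewrite tensmxE mxE eq_sym (negPf c'c) mulr0 mul0r.
Qed.

Lemma tens_quad t M :
  (t^T *m (M *t (1%:M : 'M[R]_n)) *m t) 0 0 =
  \sum_j \sum_k M j k * gram (tens_coord t) j k.
Proof.
rewrite -mulmxA mxE sum_mxtens; apply: eq_bigr => j _.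
under eq_bigr => c _ do rewrite tens_coord_mul mxE mulr_sumr.
rewrite exchange_big/=; apply: eq_bigr => k _.
by rewrite mulr_sumr; apply: eq_bigr => c _; rewrite mulrCA.
Qed.

End tensor_forms.

Section potts_algebra.
Context (R : realType) (s q : nat).
Implicit Types (A : 'M[R]_s) (n g : 'I_s -> R) (y : 'I_s -> 'I_q -> R).

Definition energy A N n y : R :=
  (2 * N)^-1 * \sum_j \sum_k n j * A j k * n k * gram y j k.

Definition deviation x : 'I_s -> 'I_q -> R := fun k c => x k c - q%:R^-1.

Hypothesis q0 : (0 < q)%N.
Let q_neq0 : q%:R != 0 :> R. Proof. by rewrite pnatr_eq0 -lt0n. Qed.

Lemma gram_deviation x j k : \sum_c x j c = 1 -> \sum_c x k c = 1 ->
  gram x j k = gram (deviation x) j k + q%:R^-1.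
Proof.
move=> xj xk; rewrite /gram /deviation.
have sumqV : \sum_(c < q) q%:R^-1 = 1 :> R.
  by rewrite sumr_const card_ord -[LHS]mulr_natr mulVf.
under [in RHS]eq_bigr do rewrite mulrBl !mulrBr.
rewrite !sumrB -!mulr_suml -!mulr_sumr xj xk sumqV.
by ring.
Qed.

(** The frequencies of every block sum to 1, so centring them at 1/q changes the Hamiltonian by a
    constant, which cancels in the normalisation. *)
Lemma gibbs_weightE N (bl : 'I_N -> 'I_s) A (w : {ffun 'I_N -> 'I_q}) :
  (forall k, (0 < block_card bl k)%N) ->
  let E w := expR (energy A N%:R (fun k => (block_card bl k)%:R)
    (deviation (frac R bl w))) in
  gibbs_weight bl A w = E w / \sum_w' E w'.
Proof.
move=> bl0 E; pose n k : R := (block_card bl k)%:R.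
pose D := (2 * N%:R)^-1 * \sum_j \sum_k n j * A j k * n k * q%:R^-1.
have HE v : expR (- hamiltonian bl A v) = expR D * E v.
  rewrite -expRD; congr expR; rewrite /hamiltonian -mulNr opprK.
  rewrite /D /energy -mulrDr; congr (_ * _).
  have -> : (magnetization R bl v)^T *m blockmx_tens R q bl *m (A *t 1%:M) *m
      blockmx_tens R q bl *m magnetization R bl v =
      (magnetization R bl v)^T *m ((blockmx R bl *m A *m blockmx R bl) *t 1%:M)
      *m magnetization R bl v.
    rewrite -[_ *m _ *m (A *t _)]mulmxA -[_ *m (_ *m _) *m _]mulmxA.
    by rewrite !tensmx_mul !mul1mx.
  rewrite tens_quad -big_split/=; apply: eq_bigr => j _.
  rewrite -big_split/=; apply: eq_bigr => k _.
  have -> : tens_coord (magnetization R bl v) = frac R bl v.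
    by apply/funext => i; apply/funext => c; rewrite /tens_coord mxE mxtens_indexK.
  rewrite gram_deviation ?frac_sum1// mulrDr addrC; congr (_ * _ + _ * _).
    by rewrite /blockmx mul_mx_diag mul_diag_mx !mxE.
  by rewrite /blockmx mul_mx_diag mul_diag_mx !mxE.
rewrite /gibbs_weight; under eq_bigr do rewrite HE.
by rewrite HE -mulr_sumr -mulf_div divff ?mul1r// gt_eqF// expR_gt0.
Qed.

End potts_algebra.

Lemma sum_ord_pred (V : zmodType) q (F : 'I_q -> V) (G : 'I_q.-1 -> V) (l : 'I_q) :
    l = q.-1 :> nat -> (forall (d : 'I_q.-1) (i : 'I_q), i = d :> nat -> G d = F i) ->
  \sum_d G d = \sum_i F i - F l.
Proof.
case: q F G l => [F G []//|q] F G l lq GF.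
have -> : l = ord_max by exact: val_inj.
rewrite big_ord_recr/= addrK; apply: eq_bigr => i _.
by rewrite (GF i (widen_ord (leqnSn q) i)).
Qed.

Section rotation.
Context (R : realType) (q : nat) (Rt : 'M[R]_q) (hRt : ones_rotation Rt).
Hypothesis q0 : (0 < q)%N.

Definition proj_rot : 'M[R]_(q.-1, q) := proj_init R q *m Rt.

Let proj_rotE (d : 'I_q.-1) c (i : 'I_q) : i = d :> nat -> proj_rot d c = Rt i c.
Proof.
move=> id; rewrite mxE (bigD1 i)//= mxE -id eqxx mul1r big1 ?addr0// => j ji.
by rewrite mxE -id eq_sym (inj_eq val_inj) (negPf ji) mul0r.
Qed.

Let pred_lt : (q.-1 < q)%N. Proof. by rewrite prednK. Qed.
Let last : 'I_q := Ordinal pred_lt.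

Let rot_last c : Rt last c = (Num.sqrt q%:R)^-1.
Proof.
case: hRt => RtRt _ /(congr1 (mulmx Rt^T)); rewrite mulmxA RtRt mul1mx.
move=> /matrixP/(_ c 0); rewrite !mxE mulr1 => ->.
rewrite (bigD1 last)//= !mxE/= prednK// eqxx mulr1 big1 ?addr0// => i il.
rewrite !mxE; case: eqP => [iq|]; rewrite ?mulr0//.
by case/negP: il; rewrite -val_eqE/= -eqSS prednK//; apply/eqP.
Qed.

(** The last row of [Rt] is constant, equal to 1 / sqrt q. Dropping it from the orthogonality
    relation leaves the projection onto zero-sum vectors. *)
Lemma proj_rot_cols c c' :
  \sum_d proj_rot d c * proj_rot d c' = (c == c')%:R - q%:R^-1.
Proof.
rewrite (@sum_ord_pred _ _ (fun i => Rt i c * Rt i c') _ last)//; last first.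
  by move=> d i id; rewrite !(proj_rotE _ id).
case: (hRt) => /matrixP/(_ c c') + _ _; rewrite !mxE => <-.
rewrite !rot_last -invfM -expr2 sqr_sqrtr//.
by congr (_ - _); apply: eq_bigr => i _; rewrite mxE.
Qed.

Lemma proj_rot_rows d d' : \sum_c proj_rot d c * proj_rot d' c = (d == d')%:R.
Proof.
case: (hRt) => /mulmx1C/matrixP RtRt _ _.
have dq (e : 'I_q.-1) : (e < q)%N by rewrite (leq_trans (ltn_ord e))// leq_pred.
have := RtRt (Ordinal (dq d)) (Ordinal (dq d')); rewrite !mxE -val_eqE/= => <-.
have pE e c : proj_rot e c = Rt (Ordinal (dq e)) c by exact: proj_rotE.
by apply: eq_bigr => c _; rewrite !pE [in RHS]mxE.
Qed.

Lemma proj_rot_sum d : \sum_c proj_rot d c = 0.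
Proof.
have dq : (d < q)%N by rewrite (leq_trans (ltn_ord d))// leq_pred.
case: (hRt) => _ _ /matrixP/(_ (Ordinal dq) 0); rewrite !mxE/=.
under eq_bigr do rewrite !mxE mulr1.
rewrite -mulr_suml => /eqP.
have -> : (d.+1 == q) = false.
  by apply/negbTE; rewrite neq_ltn -[X in (_ < X)%N](prednK q0) ltnS ltn_ord.
rewrite mulf_eq0 invr_eq0 sqrtr_eq0 leNgt ltr0n q0 orbF => /eqP Rt0; rewrite -[RHS]Rt0.
by apply: eq_bigr => c _; exact: proj_rotE.
Qed.

End rotation.

Section rescaling.
Context (R : realType) (s q : nat) (Rt : 'M[R]_q) (hRt : ones_rotation Rt).
Hypothesis q0 : (0 < q)%N.
Implicit Types (y : 'I_s -> 'I_q -> R) (z : 'I_s -> 'I_q.-1 -> R).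

Definition rotate y : 'I_s -> 'I_q.-1 -> R :=
  fun k d => \sum_c proj_rot Rt d c * y k c.

(** The adjoint of [rotate]: it turns prescribed rotated coordinates into a zero-sum deviation of
    the colour frequencies. *)
Definition unrotate z : 'I_s -> 'I_q -> R :=
  fun k c => \sum_d proj_rot Rt d c * z k d.

Lemma gram_rotate y j k : \sum_c y k c = 0 -> gram (rotate y) j k = gram y j k.
Proof.
move=> yk; rewrite /gram /rotate.
under eq_bigr do rewrite mulr_suml.
rewrite exchange_big/=; apply: eq_bigr => c _.
under eq_bigr do rewrite mulr_sumr.
rewrite exchange_big/=.
rewrite (eq_bigr (fun c' => ((c == c')%:R - q%:R^-1) * (y k c' * y j c))).
  under eq_bigr do rewrite mulrBl.
  rewrite sumrB -mulr_sumr -mulr_suml yk mul0r mulr0 subr0.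
  rewrite (bigD1 c)//= eqxx mul1r big1 ?addr0 1?mulrC// => c'.
  by rewrite eq_sym => /negPf->; rewrite mul0r.
move=> c' _; rewrite -(proj_rot_cols hRt q0) mulr_suml.
by apply: eq_bigr => d _; ring.
Qed.

Lemma rotateK z k d : rotate (unrotate z) k d = z k d.
Proof.
rewrite /rotate /unrotate; under eq_bigr do rewrite mulr_sumr.
rewrite exchange_big/= (eq_bigr (fun d' => (d == d')%:R * z k d')).
  rewrite (bigD1 d)//= eqxx mul1r big1 ?addr0// => d'.
  by rewrite eq_sym => /negPf->; rewrite mul0r.
move=> d' _; rewrite -(proj_rot_rows hRt) mulr_suml.
by apply: eq_bigr => c _; rewrite mulrA.
Qed.

Lemma sum_unrotate z k : \sum_c unrotate z k c = 0.
Proof.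
rewrite exchange_big/= big1// => d _.
by rewrite -mulr_suml (proj_rot_sum hRt q0) mul0r.
Qed.

Lemma tens_coord_rescaled N (bl : 'I_N -> 'I_s) theta (w : {ffun 'I_N -> 'I_q})
    k d :
  tens_coord (rescaled_magnetization bl Rt theta w) k d =
  (block_card bl k)%:R `^ theta * rotate (deviation (frac R bl w)) k d.
Proof.
rewrite /tens_coord /rescaled_magnetization -mulmxA mxE sum_mxtens (bigD1 k)//=.
rewrite [X in _ + X]big1 ?addr0 => [|j jk]; last first.
  by rewrite big1// => c _; rewrite tensmxE mxE eq_sym (negPf jk) !mul0r.
rewrite mulr_sumr; apply: eq_bigr => c _.
rewrite tensmxE mxE eqxx mul1r mulrCA; congr (_ * _).
rewrite /diag_pow mul_diag_mx 2!mxE; congr (_ `^ _ * _).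
  by rewrite tensmxE !mxE !eqxx mulr1.
by rewrite !mxE mxtens_indexK mulr1.
Qed.

End rescaling.

Section rate_function.
Context (R : realType) (s q : nat).
Implicit Types (gamma : 'rV[R]_s) (A : 'M[R]_s) (t : 'cV[R]_(s * q.-1)).

Lemma rate_matrixE gamma A theta j k : rate_matrix q gamma A theta j k =
  q%:R * (gamma 0 j `^ (1 - 2 * theta) *+ (j == k))
  - gamma 0 j `^ (1 - theta) * A j k * gamma 0 k `^ (1 - theta).
Proof.
rewrite /rate_matrix /diag_pow mul_mx_diag mul_diag_mx !mxE.
by rewrite !eqxx !mulr1n.
Qed.

Lemma rateE gamma A theta t : rate gamma A theta t =
  2^-1 * \sum_j \sum_k rate_matrix q gamma A theta j k * gram (tens_coord t) j k.
Proof. by rewrite /rate tens_quad. Qed.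

(* The quadratic part of the entropy minus the energy, in rotated coordinates. *)
Lemma scaled_rate A theta (N : R) (n : 'I_s -> R) (y : 'I_s -> 'I_q -> R) t :
    0 < N -> (forall k, 0 < n k) ->
    (forall j k, gram (tens_coord t) j k = n j `^ theta * n k `^ theta * gram y j k) ->
  q%:R / 2 * \sum_k n k * gram y k k - energy A N n y =
  N `^ (1 - 2 * theta) * rate (\row_k (n k / N)) A theta t.
Proof.
move=> N0 n0 gramE; rewrite rateE /energy.
have powN a : N `^ a != 0 by rewrite gt_eqF ?powR_gt0.
have nN k a : (n k / N) `^ a = n k `^ a / N `^ a.
  by rewrite powRM ?invr_ge0 ?ltW// -powR_inv1 ?ltW// -powRrM mulN1r powRN.
have diag : \sum_k n k * gram y k k =
    \sum_j \sum_k (n j * gram y j k) *+ (j == k).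
  apply: eq_bigr => j _; rewrite (bigD1 j)//= eqxx mulr1n big1 ?addr0// => k.
  by rewrite eq_sym => /negPf->.
rewrite diag !mulr_sumr -sumrB; apply: eq_bigr => j _.
rewrite !mulr_sumr -sumrB; apply: eq_bigr => k _.
rewrite gramE rate_matrixE !mxE !nN.
have pow1 m : 0 < m -> m = m `^ (1 - theta) * m `^ theta.
  by move=> m0; rewrite -powRD ?subrK ?powRr1 ?ltW// (gt_eqF m0) implybT.
have powD m a b : 0 < m -> m `^ (a + b) = m `^ a * m `^ b.
  by move=> m0; rewrite powRD// (gt_eqF m0) implybT.
have N2 : N `^ (1 - theta) * N `^ (1 - theta) = N * N `^ (1 - 2 * theta).
  rewrite -{3}(powRr1 (ltW N0)) -!powD//.
  by congr (_ `^ _); ring.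
have offdiag : N `^ (1 - 2 * theta) * (n j `^ (1 - theta) / N `^ (1 - theta) *
    A j k * (n k `^ (1 - theta) / N `^ (1 - theta))) =
    n j `^ (1 - theta) * A j k * n k `^ (1 - theta) / N.
  have NN := powN (1 - 2 * theta); have N1 := powN (1 - theta).
  apply: (@mulIf _ (N * N `^ (1 - 2 * theta))).
    by rewrite mulf_neq0// gt_eqF.
  rewrite -[in LHS]N2; field; by rewrite gt_eqF// N1.
transitivity (2^-1 * (q%:R * (n j * gram y j k *+ (j == k))) -
  2^-1 * (n j `^ (1 - theta) * A j k * n k `^ (1 - theta) / N *
          (n j `^ theta * n k `^ theta * gram y j k))).
  rewrite {2}(pow1 (n j))// {1}(pow1 (n k))//.
  move: (_ * _ *+ _) => D.
  by field; rewrite gt_eqF.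
rewrite -offdiag; have [<-|_] := eqVneq j k.
  have njE : n j = n j `^ (1 - 2 * theta) * (n j `^ theta * n j `^ theta).
    rewrite -!powD// -[LHS](powRr1 (ltW (n0 j))); congr (_ `^ _); ring.
  by rewrite !mulr1n {1}njE; field; rewrite !powN.
by rewrite !mulr0n; field; rewrite !powN.
Qed.

End rate_function.

Section spectral_norm.
Context (R : realType) (n : nat).
Implicit Types (M : 'M[R]_n) (x : 'cV[R]_n).

Let sumsq x : R := \sum_i x i 0 ^+ 2.

Let l2norm_le x (r : R) : 0 <= r -> (l2norm x <= r) = (sumsq x <= r ^+ 2).
Proof.
move=> r0; rewrite -(@ler_sqrt _ (sumsq x)) ?sqr_ge0// sqrtr_sqr ger0_norm//.
Qed.

Let sumsq_scale (a : R) x : sumsq (a *: x) = a ^+ 2 * sumsq x.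
Proof. by rewrite mulr_sumr; apply: eq_bigr => i _; rewrite mxE exprMn. Qed.

(** Without a bound on this set its [sup] would not be an upper bound. *)
Let images_bounded M :
  has_ubound [set l2norm (M *m x) | x in [set x : 'cV[R]_n | l2norm x <= 1]].
Proof.
pose B := \sum_i (\sum_j `|M i j|) ^+ 2.
have B0 : 0 <= B by apply: sumr_ge0 => i _; exact: sqr_ge0.
exists (Num.sqrt B) => _ [x /= + <-]; rewrite !l2norm_le ?sqrtr_ge0// expr1n => x1.
rewrite sqr_sqrtr//; apply: ler_sum => i _.
rewrite -real_normK ?num_real// lerXn2r ?nnegrE ?sumr_ge0// mxE.
apply: le_trans (ler_norm_sum _ _ _) _; apply: ler_sum => j _.
rewrite normrM ler_piMr// -(@ler_pXn2r _ 2%N) ?nnegrE// expr1n real_normK ?num_real//.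
apply: le_trans x1; rewrite /sumsq (bigD1 j)//= lerDl.
by apply: sumr_ge0 => k _; exact: sqr_ge0.
Qed.

Lemma spectral_norm_ge0 M : 0 <= spectral_norm M.
Proof.
apply: ub_le_sup; first exact: images_bounded.
exists 0 => /=; rewrite ?mulmx0 /l2norm big1 ?sqrtr0 ?ler01// => i _;
  by rewrite mxE expr0n.
Qed.

(** Young's inequality x z <= mu x^2 / 2 + z^2 / (2 mu) stands in for Cauchy-Schwarz; the strict
    inequality makes [mu] positive even for M = 0. *)
Lemma quad_le_spectral M x mu : spectral_norm M < mu ->
  (x^T *m M *m x) 0 0 <= mu * \sum_i x i 0 ^+ 2.
Proof.
move=> Mmu; have mu0 : 0 < mu by apply: le_lt_trans Mmu; exact: spectral_norm_ge0.
have image : sumsq (M *m x) <= mu ^+ 2 * sumsq x.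
  have : 0 <= sumsq x by apply: sumr_ge0 => i _; exact: sqr_ge0.
  rewrite le_eqVlt => /predU1P[x0|x0].
    have -> : x = 0.
      apply/matrixP => i j; rewrite ord1 mxE; apply/eqP.
      move/esym/eqP: x0; rewrite psumr_eq0 => [/allP/(_ i)|k _]; last exact: sqr_ge0.
      by rewrite mem_index_enum sqrf_eq0; apply.
    suff -> : sumsq (M *m 0) = 0 by rewrite mulr_ge0 ?sqr_ge0// sumr_ge0// => i _; exact: sqr_ge0.
    by rewrite mulmx0 /sumsq big1// => i _; rewrite mxE expr0n.
  pose r := Num.sqrt (sumsq x); have r0 : 0 < r by rewrite sqrtr_gt0.
  have r2 : r ^+ 2 = sumsq x by rewrite sqr_sqrtr// ltW.
  have : l2norm (M *m (r^-1 *: x)) <= mu.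
    apply: ltW; apply: le_lt_trans Mmu; apply: ub_le_sup; first exact: images_bounded.
    exists (r^-1 *: x) => //=; rewrite l2norm_le// sumsq_scale -r2.
    by rewrite exprVn mulVf ?expr1n// gt_eqF// exprn_gt0.
  rewrite l2norm_le ?(ltW mu0)// -scalemxAr sumsq_scale exprVn r2.
  by rewrite ler_pdivrMl// mulrC.
rewrite -mulmxA mxE -/(sumsq x).
apply: (@le_trans _ _ (\sum_i (mu / 2 * x i 0 ^+ 2 + (2 * mu)^-1 * (M *m x) i 0 ^+ 2))).
  apply: ler_sum => i _; rewrite mxE; set z := (M *m x) i 0.
  rewrite -subr_ge0.
  have -> : mu / 2 * x i 0 ^+ 2 + (2 * mu)^-1 * z ^+ 2 - x i 0 * z =
    (2 * mu)^-1 * (mu * x i 0 - z) ^+ 2 by field; rewrite gt_eqF.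
  by rewrite mulr_ge0 ?sqr_ge0// invr_ge0 mulr_ge0// ltW.
rewrite big_split/= -!mulr_sumr -!/(sumsq _).
have h : (2 * mu)^-1 * sumsq (M *m x) <= (2 * mu)^-1 * (mu ^+ 2 * sumsq x).
  by rewrite ler_wpM2l// invr_ge0 mulr_ge0// ltW.
apply: le_trans (lerD (lexx _) h) _.
rewrite -subr_ge0 le_eqVlt; apply/orP; left; apply/eqP; field; by rewrite gt_eqF.
Qed.

End spectral_norm.

Section interaction.
Context (R : realType) (s q : nat).
Implicit Types (A : 'M[R]_s) (gamma : 'rV[R]_s) (y : 'I_s -> 'I_q -> R).

Lemma quad_le_scaled_interaction gamma A mu y :
    spectral_norm (scaled_interaction q gamma A) < mu ->
  \sum_j \sum_k gamma 0 j `^ 2^-1 * A j k * gamma 0 k `^ 2^-1 * gram y j k <=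
  mu * \sum_k gram y k k.
Proof.
move=> Amu; pose x : 'cV[R]_(s * q) :=
  \col_i y (mxtens_unindex i).1 (mxtens_unindex i).2.
have xy : tens_coord x = y.
  by apply/funext => k; apply/funext => c; rewrite /tens_coord mxE mxtens_indexK.
have := quad_le_spectral x Amu.
rewrite sum_mxtens.
under [in X in _ <= X]eq_bigr => k _.
  under eq_bigr => c _ do rewrite -[x _ _]/(tens_coord x k c) xy expr2.
  over.
have -> : scaled_interaction q gamma A =
    (diag_mx (\row_k gamma 0 k `^ 2^-1) *m A *m diag_mx (\row_k gamma 0 k `^ 2^-1))
    *t 1%:M.
  have diag_tens : diag_pow (diag_mx gamma *t (1%:M : 'M[R]_q)) 2^-1 =
      diag_mx (\row_k gamma 0 k `^ 2^-1) *t (1%:M : 'M[R]_q).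
    apply/matrixP => i j; case: (mxtens_indexP i) => i1 i2.
    case: (mxtens_indexP j) => j1 j2; rewrite tensmxE !mxE mxtens_indexK/=.
    rewrite !eqxx !mulr1n mulr1 (can_eq (@mxtens_indexK _ _)) xpair_eqE.
    by case: eqP => _; case: eqP => _; rewrite ?mulr1n ?mulr0n ?mulr1 ?mulr0 ?mul0r.
  by rewrite /scaled_interaction diag_tens !tensmx_mul !mul1mx.
rewrite tens_quad xy; apply: le_trans.
apply: ler_sum => j _; apply: ler_sum => k _.
by rewrite mul_mx_diag mul_diag_mx !mxE.
Qed.

Lemma gram_psd A (n : 'I_s -> R) y :
    (forall v : 'I_s -> R, 0 <= \sum_j \sum_k v j * A j k * v k) ->
  0 <= \sum_j \sum_k n j * A j k * n k * gram y j k.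
Proof.
move=> A0.
have -> : \sum_j \sum_k n j * A j k * n k * gram y j k =
    \sum_c \sum_j \sum_k (n j * y j c) * A j k * (n k * y k c).
  rewrite [RHS]exchange_big/=; apply: eq_bigr => j _.
  rewrite [RHS]exchange_big/=; apply: eq_bigr => k _.
  by rewrite mulr_sumr; apply: eq_bigr => c _; ring.
exact: sumr_ge0.
Qed.

(** Merges the two alternatives. In the first, the quadratic form of A is alpha (sum v)^2 + (beta -
    alpha) sum v^2; in the second, the norm bound is at most zeta_q by [zeta_ge]. *)
Lemma potts_hypotheses gamma A : (1 <= s)%N -> (1 < q)%N ->
      [/\ exists alpha beta : R, [/\ 0 < alpha, alpha < beta &
            A = alpha *: const_mx 1 + (beta - alpha) *: 1%:M],
          forall k : 'I_s, gamma 0 k = s%:R^-1 &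
          spectral_norm (scaled_interaction q gamma A) < zeta R q]
      \/
      [/\ A^T = A, posdefmx A, forall j k : 'I_s, 0 < A j k,
          forall k : 'I_s, 0 < gamma 0 k &
          spectral_norm (scaled_interaction q gamma A)
            < 4 * ((q%:R - 1) / q%:R)] ->
  [/\ forall v : 'I_s -> R, 0 <= \sum_j \sum_k v j * A j k * v k,
      forall k, 0 < gamma 0 k &
      spectral_norm (scaled_interaction q gamma A) < zeta R q].
Proof.
move=> s1 q1 [[[a [b [a0 ab AE]]] gammaE norm_lt]|[_ Apos _ gamma0 norm_lt]].
  split=> // [v|k]; last by rewrite gammaE invr_gt0 ltr0n.
  have -> : \sum_j \sum_k v j * A j k * v k =
      a * (\sum_j v j) ^+ 2 + (b - a) * \sum_j v j ^+ 2.
    rewrite expr2 mulr_suml !mulr_sumr -big_split/=; apply: eq_bigr => j _.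
    rewrite (bigD1 j)//= [in RHS](bigD1 j)//= AE !mxE eqxx mulr1n.
    rewrite (eq_bigr (fun k => a * v j * v k)).
      by rewrite -mulr_sumr; ring.
    by move=> k kj; rewrite !mxE eq_sym (negPf kj) mulr0n; ring.
  rewrite addr_ge0// mulr_ge0 ?sqr_ge0 ?subr_ge0 ?(ltW a0) ?(ltW ab)//.
  by apply: sumr_ge0 => j _; exact: sqr_ge0.
split=> // [v|]; last by apply: lt_le_trans norm_lt _; exact: zeta_ge.
pose x : 'cV[R]_s := \col_k v k.
have -> : \sum_j \sum_k v j * A j k * v k = (x^T *m A *m x) 0 0.
  rewrite -mulmxA mxE; apply: eq_bigr => j _; rewrite !mxE mulr_sumr.
  by apply: eq_bigr => k _; rewrite mxE mulrA.
have [->|x0] := eqVneq x 0; last exact/ltW/Apos.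
by rewrite mulmx0 mxE.
Qed.

End interaction.

(** * Finite-volume bounds *)

Section gibbs_bounds.
Context (R : realType) (s q N : nat) (bl : 'I_N -> 'I_s) (A : 'M[R]_s).
Hypotheses (q0 : (0 < q)%N) (bl_gt0 : forall k, (0 < block_card bl k)%N).
Implicit Types (w : {ffun 'I_N -> 'I_q}) (B : pred {ffun 'I_N -> 'I_q}).

Definition config_energy w : R :=
  energy A N%:R (fun k => (block_card bl k)%:R) (deviation (frac R bl w)).

Definition config_entropy w : R :=
  \sum_k (block_card bl k)%:R * relent (frac R bl w k).

Let q0R : 0 < q%:R :> R. Proof. by rewrite ltr0n. Qed.

Let Z : R := \sum_w expR (config_energy w).

Let Z_gt0 : 0 < Z.
Proof.
pose w0 : {ffun 'I_N -> 'I_q} := [ffun=> Ordinal q0].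
rewrite /Z (bigD1 w0)//=; apply: ltr_pwDl; first exact: expR_gt0.
by apply: sumr_ge0 => w _; exact: expR_ge0.
Qed.

Let card_configs : \sum_(w : {ffun 'I_N -> 'I_q}) (1 : R) = q%:R ^+ N.
Proof. by rewrite sumr_const card_ffun !card_ord -natrX. Qed.

Lemma gibbs_upper B C :
    (forall v : 'I_s -> R, 0 <= \sum_j \sum_k v j * A j k * v k) ->
    (forall w, B w -> config_energy w - config_entropy w <= C) ->
  \sum_(w | B w) gibbs_weight bl A w <= N.+1%:R ^+ (s * q) * expR C.
Proof.
move=> A0 BC; have ZN : q%:R ^+ N <= Z.
  rewrite -card_configs; apply: ler_sum => w _; rewrite -expR0 ler_expR.
  apply: mulr_ge0; first by rewrite invr_ge0 mulr_ge0.
  exact: (gram_psd (fun k => (block_card bl k)%:R)).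
under eq_bigr do rewrite gibbs_weightE// -!/(config_energy _).
rewrite -mulr_suml ler_pdivrMr//.
apply: (@le_trans _ _ (\sum_w expR C * expR (config_entropy w))).
  rewrite [leRHS](bigID B)/= ler_wpDr//.
    by apply: sumr_ge0 => w _; rewrite mulr_ge0 ?expR_ge0.
  by apply: ler_sum => w /BC ?; rewrite -expRD ler_expR -lerBlDr.
rewrite -mulr_sumr [leRHS]mulrAC mulrC ler_wpM2r ?expR_ge0//.
apply: le_trans (sum_expR_relent_le _ bl_gt0 q0) _.
by rewrite ler_wpM2l// exprn_ge0.
Qed.

(** As energy is at most entropy, the counting bound also bounds the partition function from above.
    The window [h] has probability at least 1/2 under the product law [p], and inside it the
    Boltzmann factor is at least q^N exp C times the weight of that law. *)
Lemma gibbs_lower B (p : 'I_s -> 'I_q -> R) (h : 'I_s -> R) C :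
    (forall w, config_energy w <= config_entropy w) ->
    (forall k c, 0 < p k c) -> (forall k, \sum_c p k c = 1) ->
    (forall k, 0 < h k <= 2) ->
    \sum_k \sum_(c < q) 2 * expR (- ((block_card bl k)%:R * h k ^+ 2 / 8)) <= 2^-1 ->
    (forall w, (forall k c, `|frac R bl w k c - p k c| <= h k) -> B w /\
      C <= config_energy w - \sum_k (block_card bl k)%:R *
                               \sum_c frac R bl w k c * ln (q%:R * p k c)) ->
  (2 * N.+1%:R ^+ (s * q))^-1 * expR C <= \sum_(w | B w) gibbs_weight bl A w.
Proof.
move=> ED p0 p1 h02 tail BC; have ZN : Z <= N.+1%:R ^+ (s * q) * q%:R ^+ N.
  apply: le_trans (sum_expR_relent_le _ bl_gt0 q0).
  by apply: ler_sum => w _; rewrite ler_expR.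
pose good w := [forall k, forall c, `|frac R bl w k c - p k c| <= h k].
have good_half : 2^-1 <= \sum_(w | good w) \prod_i p (bl i) (w i).
  have := sum_prod_weight bl p1; rewrite (bigID good)/=.
  have := concentration bl_gt0 (fun k c => ltW (p0 k c)) p1 h02.
  move=> /le_trans/(_ tail); rewrite -/(good _); lra.
under eq_bigr do rewrite gibbs_weightE// -!/(config_energy _).
rewrite -mulr_suml ler_pdivlMr//.
apply: (@le_trans _ _ (2^-1 * q%:R ^+ N * expR C)).
  rewrite mulrAC ler_wpM2r ?expR_ge0// invfM.
  rewrite -mulrA ler_wpM2l// ler_pdivrMl// exprn_gt0//.
apply: (@le_trans _ _ (\sum_(w | good w) q%:R ^+ N * \prod_i p (bl i) (w i) * expR C)).
  rewrite -mulr_suml -mulr_sumr ler_wpM2r ?expR_ge0// mulrC.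
  by rewrite ler_wpM2l// exprn_ge0// ltW.
rewrite [leRHS](bigID good)/= ler_wpDr//.
  by apply: sumr_ge0 => w _; exact: expR_ge0.
rewrite [leRHS]big_mkcondl/=; apply: ler_sum => w /forallP gw.
have [k c|-> CE] := BC w; first by have /forallP := gw k; apply.
have -> : q%:R ^+ N * \prod_i p (bl i) (w i) =
    expR (\sum_k (block_card bl k)%:R * \sum_c frac R bl w k c * ln (q%:R * p k c)).
  rewrite -sum_sites// expR_sum.
  rewrite [RHS](eq_bigr (fun i => q%:R * p (bl i) (w i))); last first.
    by move=> i _; rewrite lnK// posrE mulr_gt0.
  by rewrite big_split/= prodr_const card_ord.
by rewrite -expRD ler_expR addrC -lerBrDr.
Qed.

End gibbs_bounds.

Section quadratic_estimates.
Context (R : realType) (s q : nat).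
Implicit Types (y : 'I_s -> 'I_q -> R).

Lemma gram_ge0 m (z : 'I_s -> 'I_m -> R) k : 0 <= gram z k k.
Proof. by apply: sumr_ge0 => c _; rewrite -expr2 sqr_ge0. Qed.

Lemma norm_gram_le m (z : 'I_s -> 'I_m -> R) j k :
  `|gram z j k| <= \sum_i gram z i i.
Proof.
have le_sum i : gram z i i <= \sum_i gram z i i.
  by rewrite (bigD1 i)//= lerDl sumr_ge0// => ? _; exact: gram_ge0.
apply: (@le_trans _ _ ((gram z j j + gram z k k) / 2)); last first.
  have := le_sum j; have := le_sum k; lra.
apply: (@le_trans _ _ (\sum_c `|z j c * z k c|)); first exact: ler_norm_sum.
rewrite /gram -big_split/= mulr_suml; apply: ler_sum => c _.
rewrite normrM -!expr2 -[z j c ^+ 2]real_normK ?num_real//.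
rewrite -[z k c ^+ 2]real_normK ?num_real//.
have := sqr_ge0 (`|z j c| - `|z k c|); lra.
Qed.

Lemma norm_quad_gram_le m (z : 'I_s -> 'I_m -> R) (c : 'I_s -> 'I_s -> R) :
  `|\sum_j \sum_k c j k * gram z j k| <=
  (\sum_j \sum_k `|c j k|) * \sum_i gram z i i.
Proof.
apply: le_trans (ler_norm_sum _ _ _) _; rewrite mulr_suml; apply: ler_sum => j _.
apply: le_trans (ler_norm_sum _ _ _) _; rewrite mulr_suml; apply: ler_sum => k _.
by rewrite normrM ler_wpM2l// norm_gram_le.
Qed.

(** The spectral norm refers to the limiting densities; [rho] absorbs the excess of the actual
    densities [n k / N] over them. *)
Lemma energy_le (gamma : 'rV[R]_s) (A : 'M[R]_s) mu rho N (n : 'I_s -> R) y :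
    spectral_norm (scaled_interaction q gamma A) < mu ->
    (forall k, 0 < gamma 0 k) -> 0 < N -> (forall k, 0 <= n k) ->
    (forall k, n k / N <= rho * gamma 0 k) ->
  energy A N n y <= mu * rho / 2 * \sum_k n k * gram y k k.
Proof.
move=> Amu gamma0 N0 n0 nrho.
have mu0 : 0 < mu by apply: le_lt_trans Amu; exact: spectral_norm_ge0.
pose r k := gamma 0 k `^ 2^-1.
have r2 k : r k * r k = gamma 0 k.
  rewrite -powRD ?(gt_eqF (gamma0 k)) ?implybT//.
  by rewrite (_ : 2^-1 + 2^-1 = 1) ?powRr1 ?ltW//; lra.
have r0 k : r k != 0 by rewrite gt_eqF// powR_gt0.
(* Testing against [y'] makes the weights [n k / N] appear exactly. *)
pose y' k c := n k / N / r k * y k c.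
have gramE j k : gram y' j k = n j / N / r j * (n k / N / r k) * gram y j k.
  by rewrite mulr_sumr; apply: eq_bigr => c _; rewrite /y'; ring.
have := quad_le_scaled_interaction y' Amu.
have -> : \sum_j \sum_k gamma 0 j `^ 2^-1 * A j k * gamma 0 k `^ 2^-1 *
    gram y' j k = 2 / N * energy A N n y.
  rewrite mulrA mulr_sumr; apply: eq_bigr => j _.
  rewrite mulr_sumr; apply: eq_bigr => k _.
  by rewrite gramE -!/(r _); field; rewrite !r0 gt_eqF.
move=> h; have {}h : energy A N n y <= N / 2 * (mu * \sum_k gram y' k k).
  by rewrite mulrC -ler_pdivrMr ?divr_gt0// mulrC invf_div.
apply: (le_trans h); rewrite !mulr_sumr; apply: ler_sum => k _.
have -> : N / 2 * (mu * gram y' k k) =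
    mu / 2 * (n k * gram y k k / gamma 0 k * (n k / N)).
  by rewrite gramE -r2; field; rewrite r0 gt_eqF.
have -> : mu * rho / 2 * (n k * gram y k k) =
    mu / 2 * (n k * gram y k k / gamma 0 k * (rho * gamma 0 k)).
  by field; rewrite gt_eqF.
rewrite ler_wpM2l ?divr_ge0 ?(ltW mu0)// ler_wpM2l ?nrho//.
by rewrite divr_ge0 ?mulr_ge0 ?gram_ge0// ltW.
Qed.

Lemma rate_close (g gamma : 'rV[R]_s) (A : 'M[R]_s) theta (t : 'cV[R]_(s * q.-1)) :
  `|rate g A theta t - rate gamma A theta t| <=
  (\sum_j \sum_k `|rate_matrix q g A theta j k - rate_matrix q gamma A theta j k|) *
    \sum_k gram (tens_coord t) k k.
Proof.
rewrite !rateE -mulrBr -sumrB.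
under eq_bigr => j _.
  rewrite -sumrB; under eq_bigr => k _ do rewrite -mulrBl.
  over.
rewrite normrM ger0_norm ?invr_ge0// -[leRHS]mul1r ler_pM//.
  by lra.
exact: norm_quad_gram_le.
Qed.

(** [scaled_rate] at N = 1 with blocks of size [gamma] presents the rate as (q/2) sum gamma |y|^2
    minus an energy, which [energy_le] bounds with rho = 1. *)
Lemma rate_coercive (Rt : 'M[R]_q) (gamma : 'rV[R]_s) (A : 'M[R]_s) mu theta
    (t : 'cV[R]_(s * q.-1)) :
    ones_rotation Rt -> (0 < q)%N ->
    spectral_norm (scaled_interaction q gamma A) < mu ->
    (forall k, 0 < gamma 0 k) ->
  (q%:R - mu) / 2 * \sum_k gamma 0 k `^ (1 - 2 * theta) * gram (tens_coord t) k k
    <= rate gamma A theta t.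
Proof.
move=> hRt q0 Amu gamma0.
pose y k c := gamma 0 k `^ (- theta) * unrotate Rt (tens_coord t) k c.
have gramE j k : gram y j k =
    gamma 0 j `^ (- theta) * gamma 0 k `^ (- theta) * gram (tens_coord t) j k.
  transitivity (gamma 0 j `^ (- theta) * gamma 0 k `^ (- theta) *
      gram (unrotate Rt (tens_coord t)) j k).
    by rewrite mulr_sumr; apply: eq_bigr => c _; rewrite /y; ring.
  rewrite -(@gram_rotate R s q Rt hRt q0 _ j k) ?sum_unrotate//.
  congr (_ * gram _ _ _); apply/funext => i; apply/funext => d.
  exact: rotateK.
have powK k a : gamma 0 k `^ a * gamma 0 k `^ (- a) = 1.
  by rewrite powRN mulfV// gt_eqF// powR_gt0.
have := @scaled_rate R s q A theta 1 (gamma 0) y t ltr01 gamma0.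
rewrite powR1 mul1r; have -> : \row_k (gamma 0 k / 1) = gamma.
  by apply/rowP => k; rewrite mxE divr1.
move=> <-; last first.
  move=> j k; rewrite gramE mulrA mulrACA !powK; ring.
have := @energy_le gamma A mu 1 1 (gamma 0) y Amu gamma0 ltr01
  (fun k => ltW (gamma0 k)).
move=> h; have {}h := h (fun k => ltac:(by rewrite divr1 mul1r)).
have -> : \sum_k gamma 0 k `^ (1 - 2 * theta) * gram (tens_coord t) k k =
    \sum_k gamma 0 k * gram y k k.
  apply: eq_bigr => k _; rewrite gramE mulrA; congr (_ * _).
  rewrite -{2}(powRr1 (ltW (gamma0 k))) -!powRD ?(gt_eqF (gamma0 k)) ?implybT//.
  by congr (_ `^ _); ring.
lra.
Qed.

End quadratic_estimates.

(* With [v = q h x] and [y = f - 1/q], the summand [f ln (1 + v)] is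
   [v / q + q y h x - q (h x)^2 / 2] up to cubic terms, and
   [q y h x - q (h x)^2 / 2 <= q y^2 / 2]. *)
Lemma tilted_log_likelihood_le (R : realType) (q : nat) (f x : 'I_q -> R)
    (h X e : R) :
    (0 < q)%N -> (forall c, 0 <= f c) -> \sum_c f c = 1 -> \sum_c x c = 0 ->
    0 <= h -> 0 <= e -> (forall c, `|x c| <= X) -> q%:R * (h * X) <= 2^-1 ->
    (forall c, `|f c - (q%:R^-1 + h * x c)| <= h * e) ->
  \sum_c f c * ln (q%:R * (q%:R^-1 + h * x c)) <=
  q%:R / 2 * \sum_c (f c - q%:R^-1) ^+ 2 +
  h ^+ 3 * (q%:R ^+ 3 * (X ^+ 2 * (X + e) / 2 + X ^+ 3)).
Proof.
move=> q0 f0 f1 x0 h0 e0 xX hX fx; set Q : R := q%:R.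
have Q0 : 0 < Q by rewrite ltr0n.
have Q00 : Q != 0 by rewrite gt_eqF.
have X0 : 0 <= X by rewrite (le_trans _ (xX (Ordinal q0))).
have term c : f c * ln (Q * (Q^-1 + h * x c)) <= h * x c +
    Q / 2 * (f c - Q^-1) ^+ 2 + h ^+ 3 * (Q ^+ 2 * (X ^+ 2 * (X + e) / 2)) +
    f c * (h ^+ 3 * (Q ^+ 3 * X ^+ 3)).
  set v := Q * (h * x c); set y := f c - Q^-1.
  have -> : Q * (Q^-1 + h * x c) = 1 + v by rewrite mulrDr mulfV.
  have vX : `|v| <= Q * (h * X).
    by rewrite !normrM (gtr0_norm Q0) (ger0_norm h0) !ler_wpM2l ?(ltW Q0).
  have v3 : `|v| ^+ 3 <= h ^+ 3 * (Q ^+ 3 * X ^+ 3).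
    have -> : h ^+ 3 * (Q ^+ 3 * X ^+ 3) = (Q * (h * X)) ^+ 3 by ring.
    by rewrite lerXn2r// nnegrE ?mulr_ge0// ltW.
  have v2 : v ^+ 2 <= Q ^+ 2 * (h ^+ 2 * X ^+ 2).
    have -> : Q ^+ 2 * (h ^+ 2 * X ^+ 2) = (Q * (h * X)) ^+ 2 by ring.
    by rewrite -real_normK ?num_real// lerXn2r// nnegrE ?mulr_ge0// ltW.
  have yX : - y <= h * (X + e).
    have := fx c; rewrite -/Q ler_norml => /andP[lo _].
    have : `|h * x c| <= h * X by rewrite normrM (ger0_norm h0) ler_wpM2l.
    by rewrite ler_norml => /andP[lo' _]; rewrite /y; lra.
  have hXe : 0 <= h * (X + e) by rewrite mulr_ge0// addr_ge0.
  have yv2 : - y * v ^+ 2 <= h * (X + e) * (Q ^+ 2 * (h ^+ 2 * X ^+ 2)).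
    apply: (@le_trans _ _ (h * (X + e) * v ^+ 2)).
      by rewrite ler_wpM2r ?sqr_ge0.
    by rewrite ler_wpM2l.
  have := ler_wpM2l (f0 c) (ln1D_le (le_trans vX hX)).
  have := ler_wpM2l (f0 c) v3.
  have : y * v - v ^+ 2 / (2 * Q) <= Q / 2 * y ^+ 2.
    rewrite -subr_ge0.
    have -> : Q / 2 * y ^+ 2 - (y * v - v ^+ 2 / (2 * Q)) =
      Q / 2 * (y - v / Q) ^+ 2 by field.
    by rewrite mulr_ge0 ?sqr_ge0// divr_ge0// ltW.
  have fE : f c * (v - v ^+ 2 / 2 + `|v| ^+ 3) = h * x c +
    (y * v - v ^+ 2 / (2 * Q)) + - y * v ^+ 2 / 2 + f c * `|v| ^+ 3.
    by rewrite /y /v; field.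
  rewrite fE; lra.
apply: le_trans (ler_sum _ (fun c _ => term c)) _.
rewrite !big_split/= -!mulr_sumr x0 -mulr_suml f1 sumr_const card_ord mulr0 add0r.
rewrite -addrA lerD2l -[_ *+ q]mulr_natr -/Q.
rewrite le_eqVlt; apply/orP; left; apply/eqP; ring.
Qed.

(** * Large blocks *)

Section asymptotics.
Context (R : realType).

Lemma cvg_powR (u : nat -> R) (l a : R) : 0 < l ->
  u @ \oo --> l -> (fun N => u N `^ a) @ \oo --> l `^ a.
Proof.
move=> l0 ul; apply: (@continuous_cvg _ _ _ _ _ _ (fun x : R => x `^ a)) => //.
apply: (@differentiable_continuous _ _ _ _ (fun x : R => x `^ a)).
by apply/derivable1_diffP/derivable_powR; rewrite in_itv/= l0.
Qed.

Lemma near_le_powR (a C : R) : 0 < a -> \forall N \near \oo, C <= N%:R `^ a.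
Proof.
move=> a0; have C0 : 0 <= `|C| by [].
near=> N; apply: le_trans (ler_norm C) _.
have -> : `|C| = (`|C| `^ a^-1) `^ a.
  by rewrite -powRrM mulVf ?gt_eqF// powRr1.
rewrite ge0_ler_powR ?nnegrE ?powR_ge0 ?(ltW a0)//.
by near: N; exact: nbhs_infty_ger.
Unshelve. all: by end_near. Qed.

Lemma near_poly_le_expR (m : nat) (a e : R) : 0 < a -> 0 < e ->
  \forall N \near \oo, 2 * N.+1%:R ^+ m <= expR (e * N%:R `^ a).
Proof.
move=> a0 e0; pose b := a / 2; have b0 : 0 < b by rewrite divr_gt0.
(* [ln x <= x^b / b], and [x^b] is negligible against [x^a] *)
have ln_le (x : R) : 0 < x -> ln x <= x `^ b / b.
  move=> x0; rewrite ler_pdivlMr// mulrC -ln_powR.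
  by apply: ltW; apply: ln_sublinear; rewrite powR_gt0.
near=> N; have N0 : 0 < N%:R :> R by rewrite ltr0n; near: N; exact: nbhs_infty_gt.
have N1 : 0 < N.+1%:R :> R by rewrite ltr0n.
rewrite -ler_ln ?posrE ?expR_gt0 ?mulr_gt0 ?exprn_gt0// expRK.
rewrite lnM ?posrE ?exprn_gt0// lnXn// -[_ *+ m]mulr_natr.
have N1b : N.+1%:R `^ b <= 2 `^ b * N%:R `^ b.
  rewrite -powRM// ge0_ler_powR ?nnegrE ?(ltW b0) ?mulr_ge0//.
  by rewrite -natrM ler_nat mul2n -addnn -addn1 leq_add2l -(ltr_nat R).
have lnN : ln N.+1%:R <= 2 `^ b * N%:R `^ b / b.
  by apply: le_trans (ln_le _ N1) _; rewrite ler_pM2r ?invr_gt0.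
have -> : N%:R `^ a = N%:R `^ b * N%:R `^ b.
  rewrite -powRD ?(gt_eqF N0) ?implybT//; congr (_ `^ _); rewrite /b; lra.
have N1B : 1 <= N%:R `^ b by near: N; exact: near_le_powR.
have NC : (ln 2 + 2 `^ b / b * m%:R) / e <= N%:R `^ b.
  by near: N; exact: near_le_powR.
rewrite ler_pdivrMr// in NC.
have ln2 : 0 <= ln 2 :> R by rewrite ln_ge0// ler1n.
have m0 : 0 <= m%:R :> R by [].
have h1 := ler_wpM2r m0 lnN.
have h2 : ln 2 <= ln 2 * N%:R `^ b by rewrite ler_peMr.
have h3 : (ln 2 + 2 `^ b / b * m%:R) * N%:R `^ b <= N%:R `^ b * e * N%:R `^ b.
  by rewrite ler_wpM2r ?powR_ge0.
apply: le_trans (lerD h2 h1) _.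
lra.
Unshelve. all: by end_near. Qed.

End asymptotics.

Section block_asymptotics.
Context (R : realType) (s : nat) (bl : forall N : nat, 'I_N -> 'I_s)
  (gamma : 'rV[R]_s).
Local Arguments bl : clear implicits.
Hypothesis s1 : (1 <= s)%N.
Hypothesis bl_nonempty :
  forall N : nat, (s <= N)%N -> forall k : 'I_s, exists i : 'I_N, bl N i = k.
Hypothesis gamma_lim : forall k : 'I_s,
  (fun N : nat => (block_card (bl N) k)%:R / N%:R : R) @ \oo --> gamma 0 k.
Hypothesis gamma0 : forall k, 0 < gamma 0 k.

Let n N k : R := (block_card (bl N) k)%:R.

Definition density N : 'rV[R]_s := \row_k (n N k / N%:R).

Lemma near_block_card_gt0 :
  \forall N \near \oo, (0 < N)%N /\ forall k, (0 < block_card (bl N) k)%N.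
Proof.
near=> N; have sN : (s <= N)%N by near: N; exact: nbhs_infty_ge.
split=> [|k]; first exact: leq_trans sN.
have [i ik] := bl_nonempty sN k.
by apply/card_gt0P; exists i; apply: mem_set; apply/eqP.
Unshelve. all: by end_near. Qed.

Lemma block_card_le N k : n N k <= N%:R.
Proof. by rewrite ler_nat -[leqRHS]card_ord max_card. Qed.

Lemma near_density_le rho : 1 < rho ->
  \forall N \near \oo, forall k, n N k / N%:R <= rho * gamma 0 k.
Proof.
move=> rho1; apply: filter_forall => k.
have : gamma 0 k < rho * gamma 0 k by rewrite ltr_pMl.
exact: (cvgr_le (gamma 0 k) (@gamma_lim k)).
Qed.

Lemma near_density_ge rho : rho < 1 ->
  \forall N \near \oo, forall k, rho * gamma 0 k <= n N k / N%:R.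
Proof.
move=> rho1; apply: filter_forall => k.
have : rho * gamma 0 k < gamma 0 k by rewrite gtr_pMl.
exact: (cvgr_ge (gamma 0 k) (@gamma_lim k)).
Qed.

Lemma near_block_powR_ge (a C : R) : 0 < a ->
  \forall N \near \oo, forall k, C <= n N k `^ a.
Proof.
move=> a0; apply: filter_forall => k.
have half : \forall N \near \oo, 2^-1 * gamma 0 k <= n N k / N%:R.
  have h1 : 2^-1 < 1 :> R by rewrite invf_lt1// ltr1n.
  by apply: filterS (near_density_ge h1) => N; apply.
near=> N; have N0 : 0 < N%:R :> R by rewrite ltr0n; near: N; exact: nbhs_infty_gt.
have h0 : 0 <= 2^-1 * gamma 0 k by rewrite mulr_ge0// ltW.
have nN : 2^-1 * gamma 0 k * N%:R <= n N k.
  by rewrite -ler_pdivlMr//; near: N.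
apply: (@le_trans _ _ ((2^-1 * gamma 0 k * N%:R) `^ a)); last first.
  by rewrite ge0_ler_powR ?nnegrE ?(ltW a0) ?(mulr_ge0 h0).
rewrite powRM// -ler_pdivrMl ?powR_gt0 ?mulr_gt0//.
by near: N; exact: near_le_powR.
Unshelve. all: by end_near. Qed.

Lemma near_block_powRN_le (a e : R) : 0 < a -> 0 < e ->
  \forall N \near \oo, forall k, n N k `^ (- a) <= e.
Proof.
move=> a0 e0; have := near_block_powR_ge e^-1 a0.
apply: filterS => N h k; rewrite powRN -[e]invrK lef_pV2 ?posrE ?invr_gt0//.
by apply: lt_le_trans (h k); rewrite invr_gt0.
Qed.

Lemma rate_matrix_cvg q (A : 'M[R]_s) theta e : 0 < e ->
  \forall N \near \oo, \sum_j \sum_k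
    `|rate_matrix q (density N) A theta j k - rate_matrix q gamma A theta j k| <= e.
Proof.
move=> e0; have cvg_pow k a : (fun N => density N 0 k `^ a) @ \oo --> gamma 0 k `^ a.
  apply: cvg_powR => //.
  rewrite (_ : (fun N => _) = (fun N => n N k / N%:R)); first exact: gamma_lim.
  by apply/funext => N; rewrite mxE.
have cvg_entry j k : (fun N => rate_matrix q (density N) A theta j k) @ \oo -->
    rate_matrix q gamma A theta j k.
  rewrite (_ : (fun N => _) = (fun N =>
      q%:R * (density N 0 j `^ (1 - 2 * theta) *+ (j == k)) -
      density N 0 j `^ (1 - theta) * A j k * density N 0 k `^ (1 - theta))).
    rewrite rate_matrixE.
    apply: cvgB; last by apply: cvgM => //; apply: cvgM => //; exact: cvg_cst.
    by apply: cvgM; [exact: cvg_cst|apply: cvgMn].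
  by apply/funext => N; rewrite rate_matrixE.
pose e' := e / (s * s)%:R.
have ss0 : 0 < (s * s)%:R :> R by rewrite ltr0n muln_gt0 s1.
have e'0 : 0 < e' by rewrite divr_gt0.
have : \forall N \near \oo, forall j k,
    `|rate_matrix q (density N) A theta j k - rate_matrix q gamma A theta j k| <= e'.
  apply: filter_forall => j; apply: filter_forall => k.
  near=> N; rewrite distrC; near: N.
  by move: e' e'0; apply/cvgrPdist_le; exact: cvg_entry.
apply: filterS => N h.
apply: (@le_trans _ _ (\sum_(j < s) \sum_(k < s) e')).
  by apply: ler_sum => j _; apply: ler_sum => k _; exact: h.
rewrite !sumr_const !card_ord -mulrnA -[_ *+ _]mulr_natr.
by rewrite /e' divfK// gt_eqF.
Unshelve. all: by end_near. Qed.

End block_asymptotics.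

(** The inverse of a sum of inverses is below each term; the added 1 keeps it positive when [I] is
    empty. *)
Lemma exists_pos_lower_bound (R : realFieldType) (I : finType) (f : I -> R) :
  (forall i, 0 < f i) -> exists2 m, 0 < m & forall i, m <= f i.
Proof.
move=> f0; exists (1 + \sum_i (f i)^-1)^-1 => [|i].
  by rewrite invr_gt0 ltr_pwDl// sumr_ge0// => i _; rewrite invr_ge0 ltW.
rewrite -[leRHS]invrK lef_pV2 ?posrE ?invr_gt0//; last first.
  by rewrite ltr_pwDl// sumr_ge0// => j _; rewrite invr_ge0 ltW.
rewrite (bigD1 i)//= addrCA lerDl addr_ge0// sumr_ge0// => j _.
by rewrite invr_ge0 ltW.
Qed.

(** * Free energy on the moderate scale and Gibbs probabilities *)

Section moderate_deviations.
Context (R : realType) (s q : nat) (bl : forall N : nat, 'I_N -> 'I_s)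
  (gamma : 'rV[R]_s) (A : 'M[R]_s) (Rt : 'M[R]_q) (theta : R).
Local Arguments bl : clear implicits.
Hypotheses (s1 : (1 <= s)%N) (q1 : (1 < q)%N).
Hypothesis bl_nonempty :
  forall N : nat, (s <= N)%N -> forall k : 'I_s, exists i : 'I_N, bl N i = k.
Hypothesis gamma_lim : forall k : 'I_s,
  (fun N : nat => (block_card (bl N) k)%:R / N%:R : R) @ \oo --> gamma 0 k.
Hypothesis hRt : ones_rotation Rt.
Hypothesis A_psd : forall v : 'I_s -> R, 0 <= \sum_j \sum_k v j * A j k * v k.
Hypothesis gamma0 : forall k, 0 < gamma 0 k.
Hypothesis norm_lt : spectral_norm (scaled_interaction q gamma A) < zeta R q.
Hypotheses (theta0 : 0 < theta) (theta12 : theta < 2^-1).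

Let n N k : R := (block_card (bl N) k)%:R.
Let a N : R := N%:R `^ (1 - 2 * theta).
Let t N (w : {ffun 'I_N -> 'I_q}) := rescaled_magnetization (bl N) Rt theta w.
Let y N (w : {ffun 'I_N -> 'I_q}) := deviation (frac R (bl N) w).
Let sqnorm (u : 'cV[R]_(s * q.-1)) : R := \sum_k gram (tens_coord u) k k.

Let q0 : (0 < q)%N. Proof. exact: ltnW. Qed.
Let expo_gt0 : 0 < 1 - 2 * theta. Proof. by have := theta12; lra. Qed.

Let sqnorm_ge0 u : 0 <= sqnorm u.
Proof. by apply: sumr_ge0 => k _; exact: gram_ge0. Qed.

Section fixed_size.
Variables (N : nat) (N0 : (0 < N)%N).
Hypothesis bl_gt0 : forall k, (0 < block_card (bl N) k)%N.
Implicit Types w : {ffun 'I_N -> 'I_q}.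

Let nN0 k : 0 < n N k. Proof. by rewrite ltr0n. Qed.
Let NR0 : 0 < N%:R :> R. Proof. by rewrite ltr0n. Qed.

Let powD k x z : n N k `^ (x + z) = n N k `^ x * n N k `^ z.
Proof. by rewrite powRD// (gt_eqF (nN0 k)) implybT. Qed.

Let sum_y w k : \sum_c y w k c = 0.
Proof.
rewrite sumrB frac_sum1// sumr_const card_ord -[_ *+ q]mulr_natr.
by rewrite mulVf ?subrr// pnatr_eq0 -lt0n.
Qed.

Let gram_t w j k : gram (tens_coord (t w)) j k =
  n N j `^ theta * n N k `^ theta * gram (y w) j k.
Proof.
rewrite -(gram_rotate hRt q0 j (sum_y w k)) mulr_sumr.
by apply: eq_bigr => d _; rewrite !tens_coord_rescaled// mulrACA.
Qed.

Let gram_y w k :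
  n N k * gram (y w) k k = n N k `^ (1 - 2 * theta) * gram (tens_coord (t w)) k k.
Proof.
rewrite gram_t 2!mulrA -!powD -[in LHS](powRr1 (ltW (nN0 k))).
by congr (_ `^ _ * _); ring.
Qed.

Let powa k : n N k `^ (1 - 2 * theta) = a N * density R bl N 0 k `^ (1 - 2 * theta).
Proof.
rewrite mxE -powRM ?divr_ge0//; congr (_ `^ _).
by rewrite mulrC divfK// gt_eqF.
Qed.

Lemma block_powR_le k : n N k `^ (1 - 2 * theta) <= a N.
Proof.
by rewrite ge0_ler_powR ?nnegrE ?(ltW expo_gt0)// block_card_le.
Qed.

(** Exact at finite N because the rate is taken at the actual densities; the passage to [gamma] is
    left to [rate_close]. *)
Lemma energy_rate w : config_energy (bl N) A w =
  q%:R / 2 * (\sum_k n N k * gram (y w) k k) - a N * rate (density R bl N) A theta (t w).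
Proof. by rewrite -(scaled_rate A NR0 nN0 (gram_t w)) subKr. Qed.

Lemma sum_gram_le w : \sum_k n N k * gram (y w) k k <= a N * sqnorm (t w).
Proof.
rewrite mulr_sumr; apply: ler_sum => k _.
by rewrite gram_y ler_wpM2r ?gram_ge0// block_powR_le.
Qed.

Lemma sum_gram_ge w m :
    (forall k, m <= density R bl N 0 k `^ (1 - 2 * theta)) ->
  a N * (m * sqnorm (t w)) <= \sum_k n N k * gram (y w) k k.
Proof.
move=> mg; rewrite !mulr_sumr; apply: ler_sum => k _.
rewrite gram_y powa -mulrA ler_wpM2l ?powR_ge0// ler_wpM2r ?gram_ge0//.
Qed.

Lemma entropy_ge w :
  zeta R q / 2 * (\sum_k n N k * gram (y w) k k) <= config_entropy R (bl N) w.
Proof.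
rewrite mulr_sumr; apply: ler_sum => k _; rewrite mulrCA ler_wpM2l//.
exact: (relent_ge q1 (frac_ge0 _ _ _ _) (frac_sum1 _ bl_gt0 _ _)).
Qed.

(** All frequencies are within h M of 1/q, so [relent_ge_near] applies with d = h M; replacing its
    constant by q / 2 costs a relative error of at most q h M. *)
Lemma entropy_ge_near w (h M : R) : 0 <= h -> sqnorm (t w) <= M ^+ 2 -> 0 <= M ->
    (forall k, n N k `^ (- theta) <= h) ->
  q%:R / 2 * (\sum_k n N k * gram (y w) k k) - a N * (q%:R ^+ 2 / 2 * h * M ^+ 3) <=
  config_entropy R (bl N) w.
Proof.
move=> h0 tM M0 nh; set Q : R := q%:R.
have Q0 : 0 < Q by rewrite ltr0n.
have yhM k c : `|y w k c| <= h * M.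
  rewrite -(@ler_pXn2r _ 2%N) ?nnegrE ?mulr_ge0// real_normK ?num_real//.
  apply: (@le_trans _ _ (gram (y w) k k)).
    by rewrite /gram (bigD1 c)//= -expr2 lerDl sumr_ge0// => ? _; rewrite -expr2 sqr_ge0.
  have -> : gram (y w) k k = n N k `^ (- theta) ^+ 2 * gram (tens_coord (t w)) k k.
    have hK : n N k `^ (- theta) * n N k `^ theta = 1 by rewrite -powD addNr powRr0.
    by rewrite gram_t expr2 mulrA mulrACA !hK !mul1r.
  rewrite exprMn ler_pM ?sqr_ge0 ?gram_ge0//.
    by rewrite lerXn2r ?nnegrE ?powR_ge0.
  apply: le_trans tM; rewrite /sqnorm (bigD1 k)//= lerDl sumr_ge0// => ? _.
  exact: gram_ge0.
have Qd : 0 < 1 + Q * (h * M) by rewrite ltr_pwDl// mulr_ge0 ?mulr_ge0// ltW.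
apply: (@le_trans _ _ (Q / 2 / (1 + Q * (h * M)) *
    \sum_k n N k * gram (y w) k k)); last first.
  rewrite mulr_sumr; apply: ler_sum => k _; rewrite mulrCA ler_wpM2l//.
  apply: (relent_ge_near q1 (frac_ge0 _ _ _ _) (frac_sum1 _ bl_gt0 _ _)).
    by rewrite mulr_ge0.
  by move=> c; exact: yhM.
set S := \sum_k _; have S0 : 0 <= S.
  by apply: sumr_ge0 => k _; rewrite mulr_ge0 ?gram_ge0.
have SaM : S <= a N * M ^+ 2.
  by apply: le_trans (sum_gram_le w) _; rewrite ler_wpM2l ?powR_ge0.
rewrite lerBlDr -lerBlDl.
apply: (@le_trans _ _ (Q / 2 * (Q * (h * M)) * S)).
  rewrite -subr_ge0.
  have -> : Q / 2 * (Q * (h * M)) * S - (Q / 2 * S - Q / 2 / (1 + Q * (h * M)) * S) =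
    Q / 2 * S * (Q * (h * M)) ^+ 2 / (1 + Q * (h * M)) by field; rewrite gt_eqF.
  by rewrite divr_ge0 ?(ltW Qd)// mulr_ge0 ?sqr_ge0// mulr_ge0// divr_ge0// ltW.
have -> : a N * (Q ^+ 2 / 2 * h * M ^+ 3) = Q / 2 * (Q * (h * M)) * (a N * M ^+ 2).
  by ring.
by rewrite ler_wpM2l// mulr_ge0 ?mulr_ge0 ?(ltW Q0)// invr_ge0.
Qed.

End fixed_size.

Lemma free_energy_coercive : exists2 kappa, 0 < kappa &
  \forall N \near \oo, forall w : {ffun 'I_N -> 'I_q},
    kappa * a N * sqnorm (t w) <= config_entropy R (bl N) w - config_energy (bl N) A w.
Proof.
have z0 := zeta_gt0 R q1; have sn0 := spectral_norm_ge0 (scaled_interaction q gamma A).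
have snz := norm_lt; set sn := spectral_norm _ in sn0 snz.
(* Midpoints: [mu] lies between the norm and zeta_q, and [rho] between 1 and zeta_q / mu. So mu rho
   < zeta_q, and the entropy constant zeta_q / 2 beats the energy constant mu rho / 2. *)
pose mu := (sn + zeta R q) / 2; pose rho := (1 + zeta R q / mu) / 2.
have mu0 : 0 < mu by rewrite /mu; lra.
have snmu : sn < mu by rewrite /mu; lra.
have rho1 : 1 < rho.
  suff : 1 < zeta R q / mu by rewrite /rho; lra.
  by rewrite ltr_pdivlMr// /mu; lra.
have murho : mu * rho = (mu + zeta R q) / 2 by rewrite /rho; field; rewrite gt_eqF.
have [m m0 mgamma] : exists2 m, 0 < m &
    forall k, m <= (2^-1 * gamma 0 k) `^ (1 - 2 * theta).
  by apply: exists_pos_lower_bound => k; rewrite powR_gt0// mulr_gt0.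
have d0 : 0 < zeta R q - mu * rho by rewrite murho /mu; lra.
exists ((zeta R q - mu * rho) / 2 * m); first by rewrite mulr_gt0// divr_gt0.
have half1 : 2^-1 < 1 :> R by rewrite invf_lt1// ltr1n.
apply: filterS3 (near_block_card_gt0 s1 bl_nonempty)
  (near_density_le gamma_lim gamma0 rho1) (near_density_ge gamma_lim gamma0 half1).
move=> N [N0 bl0] gle gge w.
have NR0 : 0 < N%:R :> R by rewrite ltr0n.
have en := energy_le (y w) snmu gamma0 NR0 (fun k => ler0n R _) gle.
have ent := entropy_ge bl0 w.
have mg k : m <= density R bl N 0 k `^ (1 - 2 * theta).
  apply: le_trans (mgamma k) _; rewrite mxE.
  have gh : 0 <= 2^-1 * gamma 0 k by rewrite mulr_ge0// ltW.
  by rewrite ge0_ler_powR ?nnegrE ?(ltW expo_gt0) ?(le_trans gh (gge k)).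
have := sum_gram_ge N0 bl0 w mg; rewrite -/(config_energy _ _ _) in en *.
set S := \sum_k _ in en ent * => hS.
have : (zeta R q - mu * rho) / 2 * (a N * (m * sqnorm (t w))) <=
    (zeta R q - mu * rho) / 2 * S by rewrite ler_wpM2l// divr_ge0// ltW.
lra.
Qed.

Lemma free_energy_local (e M : R) : 0 < e -> 0 <= M ->
  \forall N \near \oo, forall w : {ffun 'I_N -> 'I_q}, sqnorm (t w) <= M ^+ 2 ->
    a N * (rate gamma A theta (t w) - e) <=
    config_entropy R (bl N) w - config_energy (bl N) A w.
Proof.
move=> e0 M0.
have arith (S r r' D x c : R) : S - x <= D -> c * (r - r') <= c * (e / 2) ->
    x <= c * (e / 2) -> c * (r - e) <= D - (S - c * r').
  by move=> *; lra.
(* One half of [e] pays for replacing the densities by [gamma], the other, through [h], for the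
   cubic entropy error. *)
pose e1 := e / 2 / (1 + M ^+ 2).
have M1 : 0 < 1 + M ^+ 2 by rewrite ltr_pwDl// sqr_ge0.
have e10 : 0 < e1 by rewrite !divr_gt0.
pose K := q%:R ^+ 2 / 2 * M ^+ 3; have K0 : 0 <= K.
  by rewrite mulr_ge0 ?divr_ge0 ?exprn_ge0.
pose h := e / 2 / (1 + K); have h0 : 0 < h by rewrite !divr_gt0// ltr_pwDl.
apply: filterS3 (near_block_card_gt0 s1 bl_nonempty)
  (rate_matrix_cvg s1 gamma_lim gamma0 q A theta e10)
  (near_block_powRN_le gamma_lim gamma0 theta0 h0).
move=> N [N0 bl0] rm nh w tM.
have ent := entropy_ge_near bl0 (ltW h0) tM M0 nh; rewrite (energy_rate N0 bl0).
have := le_trans (ler_norm _) (rate_close gamma (density R bl N) A theta (t w)).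
rewrite -/(sqnorm (t w)) => close.
have aN0 : 0 <= a N by exact: powR_ge0.
have rM : (\sum_j \sum_k `|rate_matrix q gamma A theta j k -
    rate_matrix q (density R bl N) A theta j k|) * sqnorm (t w) <= e / 2.
  apply: (@le_trans _ _ (e1 * (1 + M ^+ 2))).
    apply: ler_pM.
    - by apply: sumr_ge0 => j _; exact: sumr_ge0.
    - exact: sqnorm_ge0.
    - apply: le_trans rm; apply: ler_sum => j _; apply: ler_sum => k _.
      rewrite [leLHS]distrC; exact: lexx.
    - by apply: (le_trans tM); rewrite lerDr.
  by rewrite /e1 divfK// gt_eqF.
have hK : q%:R ^+ 2 / 2 * h * M ^+ 3 <= e / 2.
  have -> : q%:R ^+ 2 / 2 * h * M ^+ 3 = h * K by rewrite /K; ring.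
  apply: (@le_trans _ _ (h * (1 + K))); first by rewrite ler_wpM2l ?(ltW h0)// lerDr.
  by rewrite /h divfK// gt_eqF// ltr_pwDl.
exact: arith ent (ler_wpM2l aN0 (le_trans close rM)) (ler_wpM2l aN0 hK).
Qed.

Lemma free_energy_ge (L e : R) : 0 < e ->
  \forall N \near \oo, forall w : {ffun 'I_N -> 'I_q}, L <= rate gamma A theta (t w) ->
    config_energy (bl N) A w - config_entropy R (bl N) w <= - (a N * (L - e)).
Proof.
move=> e0; have [kappa kappa0 coercive] := free_energy_coercive.
(* Outside this radius coercivity alone gives at least |L| times the speed; inside it the local
   estimate applies. *)
pose M := Num.sqrt (`|L| / kappa).
have M2 : M ^+ 2 = `|L| / kappa by rewrite sqr_sqrtr// divr_ge0// ltW.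
apply: filterS2 coercive (free_energy_local e0 (sqrtr_ge0 (`|L| / kappa))).
move=> N coercive local w Lt; rewrite -/M in local.
have aN0 : 0 <= a N by exact: powR_ge0.
suff : a N * (L - e) <= config_entropy R (bl N) w - config_energy (bl N) A w by lra.
have [tM|/ltW tM] := leP (sqnorm (t w)) (M ^+ 2).
  by apply: le_trans (local w tM); rewrite ler_wpM2l// lerB.
apply: le_trans (coercive w); rewrite [leRHS]mulrAC [leRHS]mulrC ler_wpM2l//.
rewrite M2 ler_pdivrMr// mulrC in tM; apply: le_trans tM.
have := ler_norm L; lra.
Qed.

Lemma prob_upper (F : set 'cV[R]_(s * q.-1)) (L e : R) : 0 < e ->
    (forall u, F u -> L <= rate gamma A theta u) ->
  \forall N \near \oo,
    \sum_(w : {ffun 'I_N -> 'I_q} | t w \in F) gibbs_weight (bl N) A w <=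
    expR (- (a N * (L - e))).
Proof.
move=> e0 FL; have e20 : 0 < e / 2 by rewrite divr_gt0.
apply: filterS3 (near_block_card_gt0 s1 bl_nonempty) (free_energy_ge L e20)
  (near_poly_le_expR (s * q) expo_gt0 e20).
move=> N [N0 bl0] fe poly.
have := @gibbs_upper R s q N (bl N) A q0 bl0 (fun w => t w \in F)
  (- (a N * (L - e / 2))) A_psd.
move=> h; apply: le_trans (h _) _ => [w /set_mem tF|].
  by apply: fe; exact: FL.
apply: (@le_trans _ _ (expR (e / 2 * a N) * expR (- (a N * (L - e / 2))))).
  rewrite ler_wpM2r ?expR_ge0//; apply: le_trans poly.
  by rewrite ler_peMl ?exprn_ge0// ler1n.
rewrite -expRD ler_expR; lra.
Qed.

(* The configurations are tilted to the product law with the frequencies that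
   the deviation [u0] prescribes. *)
Lemma prob_lower (G : set 'cV[R]_(s * q.-1)) (u0 : 'cV[R]_(s * q.-1)) (r L M e : R) :
    0 < e -> 0 < r -> 0 <= M ->
    (forall u, (forall k d, `|tens_coord u k d - tens_coord u0 k d| <= r) ->
       [/\ G u, rate gamma A theta u <= L & sqnorm u <= M]) ->
  \forall N \near \oo, expR (- (a N * (L + e))) <=
    \sum_(w : {ffun 'I_N -> 'I_q} | t w \in G) gibbs_weight (bl N) A w.
Proof.
move=> e0 r0 M0 Gr.
have arith (S S' v v' D c z : R) : S' <= D * S + z -> c * (v' - v) <= c * (e / 3) ->
    c * v <= c * L -> z <= c * (e / 3) ->
    - (c * (L + e / 3 + e / 3)) <= D * S - c * v' - S'.
  by move=> *; lra.
pose x := unrotate Rt (tens_coord u0); set Q : R := q%:R.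
have Q0 : 0 < Q by rewrite ltr0n.
pose X := \sum_k \sum_c `|x k c|.
have xX k c : `|x k c| <= X.
  rewrite /X (bigD1 k)//= (bigD1 c)//= -addrA lerDl addr_ge0 ?sumr_ge0// => j _.
  by rewrite sumr_ge0.
have X0 : 0 <= X by apply: sumr_ge0 => k _; apply: sumr_ge0.
(* Width of the concentration window in units of n^(-theta). The entries of [proj_rot] are at most
   1, so Q b <= r keeps the rotated coordinates within [r] of [u0]; b <= 2 is needed for
   [concentration]. *)
pose b := Num.min (r / Q) 2; have b0 : 0 < b by rewrite lt_min divr_gt0//=.
have b2 : b <= 2 by rewrite ge_min lexx orbT.
have Qbr : Q * b <= r by rewrite mulrC -ler_pdivlMr// ge_min lexx.
pose K := Q ^+ 3 * (X ^+ 2 * (X + b) / 2 + X ^+ 3).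
have K0 : 0 <= K.
  rewrite mulr_ge0 ?exprn_ge0 ?(ltW Q0)// addr_ge0 ?exprn_ge0//.
  by rewrite divr_ge0// mulr_ge0 ?exprn_ge0// addr_ge0// ltW.
pose sR : R := s%:R; have sR0 : 0 < sR by rewrite ltr0n.
pose e1 := e / 3 / (1 + M); have M1 : 0 < 1 + M by rewrite ltr_pwDl.
have e10 : 0 < e1 by rewrite !divr_gt0.
have e30 : 0 < e / 3 by rewrite divr_gt0.
(* Eventual bound for n^(-theta). The entries of the minimum keep the window at most 2, make the
   tilted frequencies positive with a valid logarithmic expansion, and hold the cubic error of all
   [s] blocks below e / 3. *)
pose h := Num.min 1 (Num.min ((2 * Q * (1 + X))^-1) (e / 3 / (sR * (1 + K)))).
have XX : 0 < 1 + X by rewrite ltr_pwDl.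
have KK : 0 < 1 + K by rewrite ltr_pwDl.
have h0 : 0 < h.
  have c1 : 0 < (2 * Q * (1 + X))^-1 by rewrite invr_gt0 !mulr_gt0.
  have c2 : 0 < e / 3 / (sR * (1 + K)) by rewrite divr_gt0// mulr_gt0.
  by rewrite !lt_min ltr01 c1 c2.
have h1 : h <= 1 by rewrite ge_min lexx.
have hX : Q * (h * X) <= 2^-1.
  apply: (@le_trans _ _ (Q * ((2 * Q * (1 + X))^-1 * (1 + X)))).
    rewrite ler_wpM2l ?(ltW Q0)// ler_pM// ?(ltW h0) ?lerDr//.
    by rewrite /h !ge_min lexx orbT.
  rewrite le_eqVlt; apply/orP; left; apply/eqP; field.
  by rewrite !gt_eqF.
have hK : sR * (h * K) <= e / 3.
  apply: (@le_trans _ _ (sR * (e / 3 / (sR * (1 + K)) * (1 + K)))).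
    rewrite ler_wpM2l ?(ltW sR0)// ler_pM// ?(ltW h0) ?lerDr//.
    by rewrite /h !ge_min lexx !orbT.
  rewrite le_eqVlt; apply/orP; left; apply/eqP; field.
  by rewrite !gt_eqF.
have [kappa kappa0 coercive] := free_energy_coercive.
near=> N.
have [N0 bl0] : (0 < N)%N /\ forall k, (0 < block_card (bl N) k)%N.
  by near: N; exact: near_block_card_gt0 s1 bl_nonempty.
have Hh : forall k, n N k `^ (- theta) <= h.
  by near: N; exact: (near_block_powRN_le gamma_lim gamma0 theta0 h0).
(* The concentration exponent is n^(1 - 2 theta) b^2 / 8; once it exceeds 4 s q, the s q tail terms
   add up to at most 1/2. *)
have tail_exp : forall k, 4 * sR * Q * 8 / b ^+ 2 <= n N k `^ (1 - 2 * theta).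
  by near: N; exact: (near_block_powR_ge gamma_lim gamma0 _ expo_gt0).
have rm : \sum_j \sum_k `|rate_matrix q (density R bl N) A theta j k -
    rate_matrix q gamma A theta j k| <= e1.
  by near: N; exact: (rate_matrix_cvg s1 gamma_lim gamma0 q A theta e10).
have poly : 2 * N.+1%:R ^+ (s * q) <= expR (e / 3 * N%:R `^ (1 - 2 * theta)).
  by near: N; exact: near_poly_le_expR.
have coerc : forall w : {ffun 'I_N -> 'I_q}, kappa * a N * sqnorm (t w) <=
    config_entropy R (bl N) w - config_energy (bl N) A w.
  by near: N; exact: coercive.
have nN0 k : 0 < n N k by rewrite ltr0n.
have aN0 : 0 <= a N by exact: powR_ge0.
pose H k := n N k `^ (- theta).
have H0 k : 0 < H k by exact: powR_gt0.
have powD k c c' : n N k `^ (c + c') = n N k `^ c * n N k `^ c'.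
  by rewrite powRD// (gt_eqF (nN0 k)) implybT.
have nH2 k : n N k * H k ^+ 2 = n N k `^ (1 - 2 * theta).
  rewrite -[X in X * _ = _](powRr1 (ltW (nN0 k))) expr2 mulrA -!powD.
  by congr (_ `^ _); ring.
pose p k c := Q^-1 + H k * x k c.
(* The two thirds of [e] cover the change of densities and the cubic error; the remaining third
   covers the polynomial factor. *)
pose C := - (a N * (L + e / 3 + e / 3)).
have ED (w : {ffun 'I_N -> 'I_q}) :
    config_energy (bl N) A w <= config_entropy R (bl N) w.
  rewrite -subr_ge0; apply: le_trans (coerc w).
  by rewrite !mulr_ge0 ?sqnorm_ge0// ltW.
have Hx k c : Q * `|H k * x k c| <= 2^-1.
  apply: le_trans hX; rewrite ler_wpM2l ?(ltW Q0)// normrM gtr0_norm//.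
  exact: ler_pM (ltW (H0 k)) (normr_ge0 _) (Hh k) (xX k c).
have p0 k c : 0 < p k c.
  have := Hx k c; rewrite mulrC -ler_pdivlMr// ler_norml => /andP[+ _].
  have : 2^-1 / Q < Q^-1 by rewrite gtr_pMl ?invr_gt0// invf_lt1// ltr1n.
  by rewrite /p; lra.
have p1 k : \sum_c p k c = 1.
  rewrite big_split/= -mulr_sumr (sum_unrotate hRt q0) mulr0 addr0.
  by rewrite sumr_const card_ord -[_ *+ _]mulr_natr mulVf// gt_eqF.
have Hb k : 0 < H k * b <= 2.
  rewrite mulr_gt0//=.
  by have := ler_pM (ltW (H0 k)) (ltW b0) (le_trans (Hh k) h1) b2; rewrite mul1r.
have tail : \sum_k \sum_(c < q)
    2 * expR (- ((block_card (bl N) k)%:R * (H k * b) ^+ 2 / 8)) <= 2^-1.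
  apply: (@le_trans _ _ (\sum_(k < s) \sum_(c < q) (2 * (4 * sR * Q)^-1))).
    apply: ler_sum => k _; apply: ler_sum => c _; rewrite ler_wpM2l//.
    have big : 4 * sR * Q <= (block_card (bl N) k)%:R * (H k * b) ^+ 2 / 8.
      have -> : (block_card (bl N) k)%:R * (H k * b) ^+ 2 / 8 =
          n N k `^ (1 - 2 * theta) * (b ^+ 2 / 8).
        by rewrite -nH2 -/(n N k); ring.
      rewrite -ler_pdivrMr ?divr_gt0 ?exprn_gt0// invf_div mulrA.
      exact: tail_exp.
    rewrite expRN lef_pV2 ?posrE ?expR_gt0 ?mulr_gt0//.
    apply: (le_trans big); apply: le_trans (expR_ge1Dx _).
    by rewrite lerDr.
  rewrite !sumr_const !card_ord -mulrnA -[_ *+ _]mulr_natr natrM -/Q -/sR.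
  rewrite le_eqVlt; apply/orP; left; apply/eqP; field.
  by rewrite !gt_eqF.
apply: (@le_trans _ _ ((2 * N.+1%:R ^+ (s * q))^-1 * expR C)).
  have poly0 : 0 < 2 * N.+1%:R ^+ (s * q) :> R by rewrite mulr_gt0// exprn_gt0.
  rewrite [leRHS]mulrC ler_pdivlMr//.
  apply: le_trans (ler_wpM2l (expR_ge0 _) poly) _.
  rewrite -expRD ler_expR -/(a N) /C; lra.
apply: (gibbs_lower q0 bl0 ED p0 p1 Hb tail) => w near_p.
have [] := Gr (t w).
  move=> k d; rewrite tens_coord_rescaled//.
  have -> : tens_coord u0 k d = rotate Rt x k d by rewrite rotateK.
  have Hinv : n N k `^ theta = (H k)^-1 by rewrite /H powRN invrK.
  rewrite -/(n N k) Hinv mulr_sumr -sumrB; apply: le_trans Qbr.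
  apply: (@le_trans _ _ (\sum_(c < q) b)); last first.
    by rewrite sumr_const card_ord -[_ *+ _]mulr_natr mulrC.
  apply: le_trans (ler_norm_sum _ _ _) _; apply: ler_sum => c _.
  have T1 : `|proj_rot Rt d c| <= 1.
    rewrite -(@ler_pXn2r _ 2%N) ?nnegrE// expr1n real_normK ?num_real//.
    have T2 : \sum_c proj_rot Rt d c * proj_rot Rt d c = 1.
      by rewrite (proj_rot_rows hRt) eqxx.
    rewrite -[leRHS]T2.
    by rewrite (bigD1 c)//= -expr2 lerDl sumr_ge0// => c' _; rewrite -expr2 sqr_ge0.
  have -> : (H k)^-1 * (proj_rot Rt d c * deviation (frac R (bl N) w) k c) -
      proj_rot Rt d c * x k c =
      proj_rot Rt d c * ((H k)^-1 * (frac R (bl N) w k c - p k c)).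
    rewrite /deviation -/Q /p; field; by rewrite (gt_eqF Q0) (gt_eqF (H0 k)).
  rewrite normrM -[b]mul1r ler_pM//.
  rewrite normrM gtr0_norm ?invr_gt0// mulrC ler_pdivrMr// mulrC.
  exact: near_p.
move=> Gt rateL tM; split; first exact: mem_set.
rewrite (energy_rate N0 bl0) /C.
have like k : n N k * \sum_c frac R (bl N) w k c * ln (Q * p k c) <=
    Q / 2 * (n N k * gram (y w) k k) + a N * (h * K).
  have := @tilted_log_likelihood_le R q (frac R (bl N) w k) (x k) (H k) X b q0
    (frac_ge0 R (bl N) w k) (frac_sum1 R bl0 w k) (sum_unrotate hRt q0 _ k)
    (ltW (H0 k)) (ltW b0) (xX k) _ (near_p k).
  rewrite -/Q -/(p k _) -/K => ht.
  have HX : Q * (H k * X) <= 2^-1.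
    exact: le_trans (ler_wpM2l (ltW Q0) (ler_wpM2r X0 (Hh k))) hX.
  have nH : n N k * H k ^+ 3 = n N k `^ (1 - 2 * theta) * H k.
    by rewrite -nH2; ring.
  apply: le_trans (ler_wpM2l (ltW (nN0 k)) (ht HX)) _.
  rewrite mulrDr mulrCA lerD//.
  rewrite mulrA nH -mulrA ler_pM ?powR_ge0//.
  - by rewrite mulr_ge0// ltW.
  - exact: block_powR_le.
  - exact: (ler_wpM2r K0 (Hh k)).
have likes : \sum_k n N k * \sum_c frac R (bl N) w k c * ln (Q * p k c) <=
    Q / 2 * (\sum_k n N k * gram (y w) k k) + \sum_(k < s) a N * (h * K).
  by rewrite mulr_sumr -big_split; apply: ler_sum => k _; exact: like.
have hKs : \sum_(k < s) a N * (h * K) <= a N * (e / 3).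
  rewrite sumr_const card_ord -[_ *+ _]mulr_natr -mulrA [h * K * _]mulrC.
  by rewrite ler_wpM2l.
have rc := le_trans (ler_norm _) (rate_close (density R bl N) gamma A theta (t w)).
have rM : (\sum_j \sum_k `|rate_matrix q (density R bl N) A theta j k -
    rate_matrix q gamma A theta j k|) * sqnorm (t w) <= e / 3.
  apply: (@le_trans _ _ (e1 * (1 + M))).
    apply: ler_pM.
    - by apply: sumr_ge0 => j _; exact: sumr_ge0.
    - exact: sqnorm_ge0.
    - exact: rm.
    - by apply: (le_trans tM); rewrite lerDr.
  by rewrite /e1 divfK// gt_eqF.
exact: arith likes (ler_wpM2l aN0 (le_trans rc rM)) (ler_wpM2l aN0 rateL) hKs.
Unshelve. all: by end_near. Qed.

End moderate_deviations.

(** * From probability bounds to the large deviation principle *)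

Section limn_bounds.
Context (R : realType).
Local Open Scope ereal_scope.

Lemma near_limn_esup_le (u : nat -> \bar R) c :
  (\forall N \near \oo, u N <= c) -> limn_esup u <= c.
Proof.
move=> [m _ uc]; apply: (@le_trans _ _ (ereal_sup (u @` [set k | (m <= k)%N]))).
  by apply: ereal_inf_lbound; exists [set k | (m <= k)%N] => //; exists m.
by apply: ge_ereal_sup => _ [k /= mk <-]; exact: uc.
Qed.

Lemma near_limn_einf_ge (u : nat -> \bar R) c :
  (\forall N \near \oo, c <= u N) -> c <= limn_einf u.
Proof.
move=> uc; rewrite /limn_einf leeNr; apply: near_limn_esup_le.
by apply: filterS uc => N; rewrite leeN2.
Qed.

End limn_bounds.

Lemma trmx_continuous (R : realType) m n : continuous (@trmx R m n).
Proof.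
move=> x S /nbhs_ballP[e e0 eS]; apply/nbhs_ballP; exists e => // y [_ xy].
by apply: eS; split=> // i j; rewrite !mxE; exact: xy.
Qed.

(** Heine-Borel, carried over from row vectors by transposition. *)
Lemma bounded_closed_compact_col (R : realType) n (D : set 'cV[R]_n) (M : R) :
  (forall x, D x -> forall i, `|x i 0| <= M) -> closed D -> compact D.
Proof.
move=> DM Dcl.
have -> : D = @trmx R 1 n @` (@trmx R 1 n @^-1` D).
  apply/seteqP; split=> [x Dx|_ [x /= ? <-]//].
  by exists x^T => /=; rewrite trmxK.
apply: continuous_compact; first exact/continuous_subspaceT/trmx_continuous.
apply: (subclosed_compact (B := [set v : 'rV[R]_n | forall i, v ord0 i \in `[(- M), M]])).
- by apply: preimage_closed => // ? _; exact: trmx_continuous.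
- apply: (@rV_compact _ _ (fun=> `[(- M), M]%classic)) => _.
  exact: segment_compact.
- move=> v /= /DM vM i; have := vM i; rewrite mxE ler_norml.
  by rewrite in_itv.
Qed.

Lemma continuous_quad_gram (R : realType) (T : topologicalType) (s n : nat)
    (c : 'I_s -> 'I_s -> R) (f : T -> 'I_s -> 'I_n -> R) :
    (forall k d, continuous (fun x => f x k d)) ->
  continuous (fun x => \sum_j \sum_k c j k * gram (f x) j k).
Proof.
move=> fc; have cont_sum (I : finType) (F : I -> T -> R) :
    (forall i, continuous (F i)) -> continuous (fun v => \sum_i F i v).
  move=> Fc; apply: (@continuous_big R I +%R 0 xpredT) => //.
  by move=> x; apply: cvgD; [exact: cvg_fst|exact: cvg_snd].
apply: (cont_sum) => j; apply: (cont_sum) => k x.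
apply: cvgM; first exact: cvg_cst.
move: x; apply: (cont_sum) => d x.
by apply: cvgM; exact: fc.
Qed.

Lemma continuous_rate (R : realType) (s q : nat) (gamma : 'rV[R]_s) (A : 'M[R]_s)
    (theta : R) : continuous (fun u : 'cV[R]_(s * q.-1) => rate gamma A theta u).
Proof.
rewrite (_ : (fun _ => _) = (fun u : 'cV[R]_(s * q.-1) => \sum_j \sum_k
    2^-1 * rate_matrix q gamma A theta j k * gram (tens_coord u) j k)); last first.
  apply/funext => v; rewrite rateE mulr_sumr; apply: eq_bigr => j _.
  by rewrite mulr_sumr; apply: eq_bigr => k _; rewrite mulrA.
apply: continuous_quad_gram => k d; exact: coord_continuous.
Qed.

Lemma law_sum (R : realType) (I : finType) (mu : fdist R I) (T : ptopologicalType)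
    (X : I -> T) (B : set T) :
  @law R I mu _ (borelType T) X B = (\sum_(i | X i \in B) mu i)%:E.
Proof.
transitivity (\sum_(i : I) (mu i)%:E * \d_(X i : borelType T) B)%E; first by [].
rewrite -sumEFin [RHS]big_mkcond/=; apply: eq_bigr => i _.
by rewrite diracE; case: (X i \in B); rewrite ?mule1 ?mule0.
Qed.

Section scaled_log.
Context (R : realType) (a S L : R).
Hypothesis a0 : 0 < a.
Local Open Scope ereal_scope.

Lemma scaled_lne_le : (S <= expR (- (a * L)))%R ->
  a^-1%:E * lne S%:E <= (- L)%:E.
Proof.
move=> SL; have aV0 : (0 < a^-1)%R by rewrite invr_gt0.
(* An event without mass has logarithm [-oo], which stays [-oo] after division by the positive
   speed. *)
have [S0|S0] := leP S 0%R; first by rewrite le0_lneNy ?lee_fin// gt0_muleNy ?leNye.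
rewrite lne_EFin// -EFinM lee_fin ler_pdivrMl// mulrN.
by rewrite -ler_expR lnK.
Qed.

Lemma scaled_lne_ge : (expR (- (a * L)) <= S)%R ->
  (- L)%:E <= a^-1%:E * lne S%:E.
Proof.
move=> SL; have S0 : (0 < S)%R by apply: lt_le_trans SL; exact: expR_gt0.
rewrite lne_EFin// -EFinM lee_fin ler_pdivlMl// mulrN.
by rewrite -ler_expR lnK.
Qed.

End scaled_log.

(** The factor q - mu of [rate_coercive] is positive for [mu] halfway between the norm and zeta_q,
    since zeta_q <= q. *)
Lemma rate_ge_gram (R : realType) (s q : nat) (gamma : 'rV[R]_s) (A : 'M[R]_s)
    (Rt : 'M[R]_q) (theta : R) : ones_rotation Rt -> (1 < q)%N ->
    (forall k, 0 < gamma 0 k) ->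
    spectral_norm (scaled_interaction q gamma A) < zeta R q ->
  exists2 kappa, 0 < kappa & forall u : 'cV[R]_(s * q.-1),
    kappa * \sum_k gram (tens_coord u) k k <= rate gamma A theta u.
Proof.
move=> hRt q1 gamma0; set sn := spectral_norm _ => snz.
have zq := zeta_le R q1; pose mu := (sn + zeta R q) / 2.
have snmu : sn < mu by rewrite /mu; lra.
have [m m0 mgamma] := exists_pos_lower_bound
  (fun k => powR_gt0 (1 - 2 * theta) (gamma0 k)).
have qmu : 0 < (q%:R - mu) / 2 by rewrite /mu; lra.
exists ((q%:R - mu) / 2 * m) => [|u]; first by rewrite mulr_gt0.
apply: le_trans (rate_coercive theta u hRt (ltnW q1) snmu gamma0).
rewrite -(mulrA _ m) ler_wpM2l ?(ltW qmu)// mulr_sumr; apply: ler_sum => k _.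
by rewrite ler_wpM2r ?gram_ge0// mgamma.
Qed.

Lemma sqr_le_sum_gram (R : realType) (s n : nat) (u : 'cV[R]_(s * n)) i :
  u i 0 ^+ 2 <= \sum_k gram (tens_coord u) k k.
Proof.
case: (mxtens_indexP i) => k d; rewrite (bigD1 k)//= {1}/gram (bigD1 d)//= -addrA.
rewrite -expr2 lerDl addr_ge0//.
  by apply: sumr_ge0 => d' _; rewrite -expr2 sqr_ge0.
by apply: sumr_ge0 => j _; exact: gram_ge0.
Qed.

Theorem theorem6 (R : realType) (s q : nat) (s1 : (1 <= s)%N) (q1 : (1 < q)%N)
    (bl : forall N : nat, 'I_N -> 'I_s)
    (bl_nonempty : forall N : nat, (s <= N)%N ->
       forall k : 'I_s, exists i : 'I_N, bl N i = k)
    (gamma : 'rV[R]_s)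
    (gamma_lim : forall k : 'I_s,
       (fun N : nat => (block_card (bl N) k)%:R / N%:R : R) @ \oo --> gamma 0 k)
    (A : 'M[R]_s)
    (Rt : 'M[R]_q) (hRt : ones_rotation Rt)
    (hA :
      [/\ exists alpha beta : R, [/\ 0 < alpha, alpha < beta &
            A = alpha *: const_mx 1 + (beta - alpha) *: 1%:M],
          forall k : 'I_s, gamma 0 k = s%:R^-1 &
          spectral_norm (scaled_interaction q gamma A) < zeta R q]
      \/
      [/\ A^T = A, posdefmx A, forall j k : 'I_s, 0 < A j k,
          forall k : 'I_s, 0 < gamma 0 k &
          spectral_norm (scaled_interaction q gamma A)
            < 4 * ((q%:R - 1) / q%:R)])
    (theta : R) (theta0 : 0 < theta) (theta12 : theta < 2^-1) :
  LDP (fun N : nat => N%:R `^ (1 - 2 * theta))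
      (fun N : nat => @law R _ (gibbs (bl N) A q1) _
         (borelType 'cV[R]_(s * q.-1)) (rescaled_magnetization (bl N) Rt theta))
      (fun t : 'cV[R]_(s * q.-1) => (rate gamma A theta t)%:E).

Proof.
have [A_psd gamma0 norm_lt] := potts_hypotheses s1 q1 hA.
have [kappa kappa0 coercive] := rate_ge_gram theta hRt q1 gamma0 norm_lt.
have sq0 (u : 'cV[R]_(s * q.-1)) : 0 <= \sum_k gram (tens_coord u) k k.
  by apply: sumr_ge0 => k _; exact: gram_ge0.
have rate0 (u : 'cV[R]_(s * q.-1)) : 0 <= rate gamma A theta u.
  by apply: le_trans (coercive u); rewrite mulr_ge0 ?(ltW kappa0).
have expo0 : 0 < 1 - 2 * theta by lra.
(* Only eventually: at N = 0 the speed is 0. *)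
have a_gt0 : \forall N \near \oo, 0 < N%:R `^ (1 - 2 * theta) :> R.
  by exists 1%N => // N /= N1; rewrite powR_gt0// ltr0n.
split.
- by move=> u; rewrite lee_fin.
- move=> c; apply: (@bounded_closed_compact_col _ _ _ (Num.sqrt (c / kappa))).
    move=> u; rewrite /= lee_fin => uc i; rewrite -sqrtr_sqr ler_wsqrtr//.
    apply: le_trans (sqr_le_sum_gram u i) _; rewrite ler_pdivlMr// mulrC.
    exact: le_trans (coercive u) uc.
  rewrite (_ : [set _ | _] = (fun u : 'cV[R]_(s * q.-1) => rate gamma A theta u) @^-1` [set x | x <= c]).
    by apply: preimage_closed => [? _|]; [exact: continuous_rate|exact: closed_le].
  by apply/seteqP; split=> u /=; rewrite lee_fin.
- move=> F _; rewrite leeNr; set l := limn_esup _.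
  have upper (L e : R) : 0 < e -> (L%:E <= ereal_inf ((fun u => (rate gamma A theta u)%:E) @` F))%E ->
      (l <= (- (L - e))%:E)%E.
    move=> e0 LF; apply: near_limn_esup_le.
    have FL u : F u -> L <= rate gamma A theta u.
      move=> Fu; rewrite -lee_fin; apply: le_trans LF _.
      by apply: ereal_inf_lbound; exists u.
    apply: filterS2 a_gt0 (prob_upper s1 q1 bl_nonempty gamma_lim hRt A_psd gamma0
      norm_lt theta0 theta12 e0 FL) => N aN pN.
    by rewrite law_sum; exact: scaled_lne_le.
  have {}upper (L : R) : (L%:E <= ereal_inf ((fun u => (rate gamma A theta u)%:E) @` F))%E ->
      (l <= (- L)%:E)%E.
    move=> LF; apply/lee_addgt0Pr => e e0; rewrite -EFinD.
    by have := upper L e e0 LF; rewrite opprB addrC.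
  (* The infimum is [+oo] when [F] is empty. The bound then holds for every real L and forces the
     upper limit to be [-oo]; a real value l is refuted by L = 1 - l. *)
  move: upper; case: (ereal_inf _) => [L upper||_]; last exact: leNye.
    by rewrite leeNr; exact: upper.
  case: l => [l|/(_ 0 (leey _))//|//] /(_ (1 - l) (leey _)).
  by rewrite lee_fin => ll; exfalso; lra.
(* It suffices to bound the lower limit by minus the rate at each single point [u0] of [G]. *)
- move=> G Gopen; rewrite leeNl; apply: le_ereal_inf_tmp => _ [u0 Gu0 <-].
  rewrite leeNl -EFinN; apply/lee_subgt0Pr => e e0.
  pose e2 := e / 2; have e20 : 0 < e2 by rewrite divr_gt0.
  pose L := rate gamma A theta u0 + e2.
  have [r r0 ballr] : exists2 r, 0 < r &
      forall u, (forall k d, `|tens_coord u k d - tens_coord u0 k d| <= r) ->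
      G u /\ rate gamma A theta u <= L.
    have : nbhs u0 (G `&` [set u | rate gamma A theta u < L]).
      apply: filterI; first exact: open_nbhs_nbhs.
      have uL : rate gamma A theta u0 < L by rewrite /L ltrDl.
      exact: (cvgr_lt _ (@continuous_rate _ _ _ gamma A theta u0) _ uL).
    move=> /nbhs_ballP[d /= d0 dG]; exists (d / 2) => [|u ur]; first by rewrite divr_gt0.
    have [|Gu /ltW uL] := dG u; last by split.
    split=> // i j; rewrite ord1; case: (mxtens_indexP i) => k c.
    rewrite /ball/= distrC; apply: le_lt_trans (ur k c) _; lra.
  (* Bounds the squared norm on the box of radius [r] around [u0], as [prob_lower] requires for
     comparing the rates at actual and limiting densities. *)
  pose M := \sum_k \sum_d (`|tens_coord u0 k d| + r) ^+ 2.
  have M0 : 0 <= M.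
    by apply: sumr_ge0 => k _; apply: sumr_ge0 => d _; exact: sqr_ge0.
  apply: near_limn_einf_ge.
  have Gr u : (forall k d, `|tens_coord u k d - tens_coord u0 k d| <= r) ->
      [/\ G u, rate gamma A theta u <= L & \sum_k gram (tens_coord u) k k <= M].
    move=> ur; have [Gu uL] := ballr u ur; split=> //.
    apply: ler_sum => k _; apply: ler_sum => d _.
    rewrite -expr2 -real_normK ?num_real// lerXn2r ?nnegrE//.
      by rewrite addr_ge0// ltW.
    rewrite -lerBlDl; apply: le_trans (ur k d); exact: lerB_dist.
  apply: filterS2 a_gt0 (prob_lower s1 q1 bl_nonempty gamma_lim hRt gamma0
      norm_lt theta0 theta12 e20 r0 M0 Gr) => N aN pN.
  rewrite law_sum -EFinB; apply: le_trans (scaled_lne_ge aN pN).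
  by rewrite lee_fin /L /e2; lra.
Qed.
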